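(* Let $n$ disks in the Euclidean plane $\mathbb{R}^2$ be given (by their centers and radii), such that the disks have $k$ different types of radii (i.e., $k$ distinct radius values). Then a maximum clique in the corresponding disk graph can be computed in $O(n^{2k}(f(n)+n^2))$ time, where $f(n)$ is the time to compute a maximum matching in an $n$-vertex bipartite graph.
   Context: The disk graph corresponding to a set of disks in $\mathbb{R}^2$ has one vertex per disk, and two vertices are adjacent if and only if the corresponding disks intersect. A maximum clique is a maximum-cardinality subset of pairwise adjacent vertices. The geometric representation (the disks themselves) is given as input. Two disks with centers $a,b$ and radii $r,r'$ intersect iff $|ab|\le r+r'$, where $|ab|$ is the Euclidean distance. *)

(* Defs.v *)
From HB Require Import structures.
From mathcomp Require Import all_boot all_order all_algebra.
From mathcomp Require Import boolp classical_sets reals.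
From mathcomp Require Import ring lra.

Set Implicit Arguments.
Unset Strict Implicit.
Unset Printing Implicit Defensive.

Import Order.TTheory GRing.Theory Num.Theory.
Local Open Scope ring_scope.

(** * Disks and disk graphs *)

Section Disks.
Variable R : realType.

Definition edist (a b : R * R) : R :=
  Num.sqrt ((a.1 - b.1) ^+ 2 + (a.2 - b.2) ^+ 2).

(* Positivity of the radius is not part of the record. *)
Record disk := Disk { center : R * R; radius : R }.

Definition disk_set (D : disk) : set (R * R) :=
  [set x | edist (center D) x <= radius D]%classic.

Definition disks_meet (D1 D2 : disk) : Prop :=
  (disk_set D1 `&` disk_set D2 !=set0)%classic.

(* The disks form a family: equal disks with different indices are different
   vertices, and they are adjacent. *)
Definition disk_graph (n : nat) (d : 'I_n -> disk) : rel 'I_n :=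
  fun i j => (i != j) && `[< disks_meet (d i) (d j) >].

Definition num_radii (n : nat) (d : 'I_n -> disk) : nat :=
  size (undup [seq radius (d i) | i <- enum 'I_n]).

Lemma edist_ge0 a b : 0 <= edist a b.
Proof. exact: sqrtr_ge0. Qed.

Lemma sqr_edist a b : edist a b ^+ 2 = (a.1 - b.1) ^+ 2 + (a.2 - b.2) ^+ 2.
Proof. by rewrite sqr_sqrtr // addr_ge0 ?sqr_ge0. Qed.

Lemma edist_le a b r : 0 <= r ->
  (edist a b <= r) = ((a.1 - b.1) ^+ 2 + (a.2 - b.2) ^+ 2 <= r ^+ 2).
Proof.
by move=> r0; rewrite -sqr_edist ler_pXn2r // nnegrE edist_ge0.
Qed.

Lemma edistC a b : edist a b = edist b a.
Proof. by congr Num.sqrt; ring. Qed.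

Lemma edist_triangle a b c : edist a c <= edist a b + edist b c.
Proof.
rewrite edist_le ?addr_ge0 ?edist_ge0 //.
have hu := sqr_edist a b; have hv := sqr_edist b c.
have u0 := edist_ge0 a b; have v0 := edist_ge0 b c.
set u := edist a b in hu u0 *; set v := edist b c in hv v0 *.
have cs : (a.1 - b.1) * (b.1 - c.1) + (a.2 - b.2) * (b.2 - c.2) <= u * v.
  apply: le_trans (ler_norm _) _.
  rewrite -(@ler_pXn2r _ 2) ?nnegrE ?normr_ge0 ?mulr_ge0 //.
  rewrite real_normK ?num_real // (exprMn _ u v) hu hv -subr_ge0.
  rewrite [X in 0 <= X](_ : _ = ((a.1 - b.1) * (b.2 - c.2)
    - (a.2 - b.2) * (b.1 - c.1)) ^+ 2) ?sqr_ge0 //; ring.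
rewrite (sqrrD u v) hu hv -subr_ge0.
rewrite [X in 0 <= X](_ : _ = (u * v -
  ((a.1 - b.1) * (b.1 - c.1) + (a.2 - b.2) * (b.2 - c.2))) *+ 2).
  by rewrite mulrn_wge0 // subr_ge0.
by ring.
Qed.

Lemma disks_meetE (D1 D2 : disk) : 0 < radius D1 -> 0 < radius D2 ->
  disks_meet D1 D2 <-> edist (center D1) (center D2) <= radius D1 + radius D2.
Proof.
case: D1 D2 => [a r] [b s] /= r0 s0; split.
  move=> [x [/= ax bx]]; apply: le_trans (edist_triangle a x b) _.
  by rewrite lerD // edistC.
move=> ab; have rs0 : 0 < r + s by rewrite addr_gt0.
have h : (a.1 - b.1) ^+ 2 + (a.2 - b.2) ^+ 2 <= (r + s) ^+ 2.
  by rewrite -edist_le // ltW.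
exists ((s * a.1 + r * b.1) / (r + s), (s * a.2 + r * b.2) / (r + s)).
have rsn0 : r + s != 0 by rewrite gt_eqF.
split; rewrite /disk_set /= edist_le ?(ltW r0) ?(ltW s0) //=.
- rewrite [leLHS](_ : _ =
    (r / (r + s)) ^+ 2 * ((a.1 - b.1) ^+ 2 + (a.2 - b.2) ^+ 2)); last by field.
  rewrite (_ : r ^+ 2 = (r / (r + s)) ^+ 2 * (r + s) ^+ 2);
    last by field.
  by rewrite ler_wpM2l ?sqr_ge0.
- rewrite [leLHS](_ : _ =
    (s / (r + s)) ^+ 2 * ((a.1 - b.1) ^+ 2 + (a.2 - b.2) ^+ 2)); last by field.
  rewrite (_ : s ^+ 2 = (s / (r + s)) ^+ 2 * (r + s) ^+ 2);
    last by field.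
  by rewrite ler_wpM2l ?sqr_ge0.
Qed.

End Disks.

(** * Cliques and matchings in finite graphs *)

Section Graphs.
Variable T : finType.
Implicit Types (e : rel T) (K : {set T}) (F : {set {set T}}).

Definition is_clique e K : Prop := {in K &, forall u v, u != v -> e u v}.

Definition is_max_clique e K : Prop :=
  is_clique e K /\ forall K', is_clique e K' -> (#|K'| <= #|K|)%N.

Definition edges e : {set {set T}} :=
  [set A | [exists u, exists v, e u v && (A == [set u; v])]].

Definition is_matching e F : Prop := F \subset edges e /\ finset.trivIset F.

Definition is_max_matching e F : Prop :=
  is_matching e F /\ forall F', is_matching e F' -> (#|F'| <= #|F|)%N.

Definition bipartite (side : T -> bool) e : Prop :=
  symmetric e /\ forall u v, e u v -> side u != side v.

End Graphs.

(** * A real RAM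

    Memory consists of arrays indexed by [nat], some holding natural numbers and
    some holding reals.  A program mentions finitely many arrays, by literal
    name; a scalar variable is cell 0 of an array.  Integers support addition,
    truncated subtraction and comparison (no multiplication, so that unit cost
    is reasonable), reals support the field operations and comparison; reals
    cannot be rounded or used as addresses, and the constants are natural
    numbers.  Every assignment and every test costs one step: the expressions in
    a fixed program have bounded size, so this agrees up to a constant factor
    with charging each operation. *)

Inductive iexp : Type :=
| ILit of nat
| ILoad of nat & iexp
| IAdd of iexp & iexp
| ISub of iexp & iexp.

Inductive rexp : Type :=
| RLit of nat
| RLoad of nat & iexp
| RAdd of rexp & rexp
| RSub of rexp & rexp
| RMul of rexp & rexp
| RDiv of rexp & rexp.

Inductive bexp : Type :=
| BILe of iexp & iexp
| BRLe of rexp & rexp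
| BNot of bexp
| BAnd of bexp & bexp.

Inductive cmd : Type :=
| Skip
| IStore of nat & iexp & iexp
| RStore of nat & iexp & rexp
| Seq of cmd & cmd
| If of bexp & cmd & cmd
| While of bexp & cmd.

Section Semantics.
Variable R : realType.

Record state := State { imem : nat -> nat -> nat; rmem : nat -> nat -> R }.

Definition upd (V : Type) (m : nat -> nat -> V) (a i : nat) (v : V) :
    nat -> nat -> V :=
  fun b j => if (b == a) && (j == i) then v else m b j.

Fixpoint ieval (st : state) (x : iexp) : nat :=
  match x with
  | ILit c => c
  | ILoad a i => imem st a (ieval st i)
  | IAdd x1 x2 => (ieval st x1 + ieval st x2)%N
  | ISub x1 x2 => (ieval st x1 - ieval st x2)%N
  end.

(* Division by zero returns zero. *)
Fixpoint reval (st : state) (x : rexp) : R :=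
  match x with
  | RLit c => c%:R
  | RLoad a i => rmem st a (ieval st i)
  | RAdd x1 x2 => reval st x1 + reval st x2
  | RSub x1 x2 => reval st x1 - reval st x2
  | RMul x1 x2 => reval st x1 * reval st x2
  | RDiv x1 x2 => reval st x1 / reval st x2
  end.

Fixpoint beval (st : state) (b : bexp) : bool :=
  match b with
  | BILe x1 x2 => (ieval st x1 <= ieval st x2)%N
  | BRLe x1 x2 => reval st x1 <= reval st x2
  | BNot b1 => ~~ beval st b1
  | BAnd b1 b2 => beval st b1 && beval st b2
  end.

(* [exec c st st' t]: started in [st], program [c] halts in [st'] after exactly
   [t] steps. *)
Inductive exec : cmd -> state -> state -> nat -> Prop :=
| ExSkip st : exec Skip st st 1
| ExIStore st a i x :
    exec (IStore a i x) st
      (State (upd (imem st) a (ieval st i) (ieval st x)) (rmem st)) 1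
| ExRStore st a i x :
    exec (RStore a i x) st
      (State (imem st) (upd (rmem st) a (ieval st i) (reval st x))) 1
| ExSeq c1 c2 st1 st2 st3 t1 t2 :
    exec c1 st1 st2 t1 -> exec c2 st2 st3 t2 ->
    exec (Seq c1 c2) st1 st3 (t1 + t2)
| ExIfTrue b c1 c2 st st' t :
    beval st b -> exec c1 st st' t -> exec (If b c1 c2) st st' t.+1
| ExIfFalse b c1 c2 st st' t :
    ~~ beval st b -> exec c2 st st' t -> exec (If b c1 c2) st st' t.+1
| ExWhileFalse b c st :
    ~~ beval st b -> exec (While b c) st st 1
| ExWhileTrue b c st1 st2 st3 t1 t2 :
    beval st1 b -> exec c st1 st2 t1 -> exec (While b c) st2 st3 t2 ->
    exec (While b c) st1 st3 (t1 + t2).+1.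

Lemma exec_deterministic c st st1 st2 t1 t2 :
  exec c st st1 t1 -> exec c st st2 t2 -> st1 = st2 /\ t1 = t2.
Proof.
move=> ex1; elim: ex1 st2 t2 => {c st st1 t1}; intros;
  match goal with H : exec _ _ ?s ?t |- _ = ?s /\ _ = ?t =>
    inversion H; subst; clear H end;
  repeat match goal with
  | hb : is_true ?b, hn : is_true (~~ ?b) |- _ => by rewrite hb in hn
  | IH : (forall s t, exec ?c ?s0 s t -> _), H : exec ?c ?s0 _ _ |- _ =>
      have [? ?] := IH _ _ H; subst; clear IH
  end; by [].
Qed.

Definition halts_within (c : cmd) (st : state) (bound : nat)
    (post : state -> Prop) : Prop :=
  exists st' t, [/\ exec c st st' t, (t <= bound)%N & post st'].

(** ** Input and output formats

    Only the cells holding the input are specified: the other cells, including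
    unused cells of the input arrays, have arbitrary initial contents. *)

(* Integer array 0: [n].  Real arrays 0, 1, 2: abscissas, ordinates, radii. *)
Definition disk_input (n : nat) (d : 'I_n -> disk R) (st : state) : Prop :=
  imem st 0 0 = n /\
  forall i : 'I_n, [/\ rmem st 0 i = (center (d i)).1,
                       rmem st 1 i = (center (d i)).2
                     & rmem st 2 i = radius (d i)].

(* Integer array 1: the indicator function of [K]. *)
Definition subset_output (n : nat) (K : {set 'I_n}) (st : state) : Prop :=
  forall i : 'I_n, imem st 1 i = (i \in K) :> nat.

(* Integer array 0: [n].  Integer array 1: the sides of the vertices.
   Integer array 2: the adjacency matrix, row by row. *)
Definition bipartite_input (n : nat) (side : 'I_n -> bool) (e : rel 'I_n)
    (st : state) : Prop :=
  [/\ imem st 0 0 = n,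
      forall u : 'I_n, imem st 1 u = side u :> nat
    & forall u v : 'I_n, imem st 2 (u * n + v)%N = e u v :> nat].

(* Integer array 3: one plus the partner of each matched vertex, and 0 for the
   other vertices. *)
Definition matching_output (n : nat) (F : {set {set 'I_n}}) (st : state) :
    Prop :=
  (forall u v : 'I_n, [set u; v] \in F -> imem st 3 u = v.+1) /\
  (forall u : 'I_n, u \notin finset.cover F -> imem st 3 u = 0%N).

End Semantics.

(* [f n] steps suffice for computing a maximum matching in any bipartite graph
   with [n] vertices. *)
Definition bipartite_matching_time (R : realType) (f : nat -> nat) : Prop :=
  exists M : cmd,
    forall (n : nat) (side : 'I_n -> bool) (e : rel 'I_n) (st : state R),
      bipartite side e -> bipartite_input side e st ->
      halts_within M st (f n) (fun st' =>
        exists F, is_max_matching e F /\ matching_output F st').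

(* Main.v *)
Require Import Defs.
From HB Require Import structures.
From mathcomp Require Import boolp classical_sets reals.
From mathcomp Require Import all_boot all_order all_algebra.
From mathcomp Require Import zify ring lra.

Set Implicit Arguments.
Unset Strict Implicit.
Unset Printing Implicit Defensive.

Import Order.TTheory GRing.Theory Num.Theory.
Local Open Scope ring_scope.

(* Guess, for each of the k radii, the leftmost and the rightmost vertex of a
   maximum clique with this radius (any vertex of the clique will do if it has
   none of this radius): n^(2k) possibilities.  Keep as candidates the vertices
   that meet all the guessed ones and lie, horizontally, between the two guessed
   vertices of their own radius.  Any two candidates above their respective
   segments meet: by convexity a disk that meets the disks at both ends of a
   segment also meets the disk of that radius around any point of the segment,
   and such a point lies straight below the lower of the two candidates.  The
   same holds below the segments, so the candidates that do not meet form a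
   bipartite graph.  In it Koenig's theorem turns a maximum matching into a
   maximum independent set, that is, a maximum clique among the candidates, by
   an alternating search that takes quadratic time. *)

(** A round is sound whatever the guess: the set it selects is independent in the graph of
    candidates that do not meet, hence a clique of disks. So wrong guesses do no harm, it suffices
    to keep the largest set found, and only one guess has to fit a maximum clique. The conflict
    graph is built on all [n] vertices, with the non-candidates isolated, so the matching program is
    called on exactly [n] vertices and costs [f n]. That program is an unknown [M] which may write
    to any array; it is relocated above the arrays of the main program, and a frame argument
    protects the latter. One program serves all [n] and [k], so it counts the radii itself and
    stores the guess as a tuple of length [2 * k]. Integers cannot be multiplied: guesses are
    enumerated by an odometer, matrix cells by a running index. Testing a vertex against a guess
    takes time proportional to [k]; since [k <= n], one round stays within a constant times
    [f n + n ^ 2], with a constant that does not depend on [k]. *)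

Section Plane.
Variable R : realType.
Implicit Types (a b p q u v : R * R) (x rho : R).

Definition sqdist a b : R := (a.1 - b.1) ^+ 2 + (a.2 - b.2) ^+ 2.

(* For [p.1 = q.1] the quotient is [0] and the value is the ordinate of [p]. *)
Definition seg_height p q x : R :=
  p.2 + (q.2 - p.2) * ((x - p.1) / (q.1 - p.1)).

Lemma sqdistC a b : sqdist a b = sqdist b a.
Proof. by rewrite /sqdist; ring. Qed.

Lemma sqdist_seg p q x v rho : p.1 <= x <= q.1 ->
  sqdist v p <= rho -> sqdist v q <= rho ->
  sqdist v (x, seg_height p q x) <= rho.
Proof.
move=> /andP[px xq] vp vq; rewrite /seg_height; set l := _ / _.
have [l0 l1 xE] : [/\ 0 <= l, l <= 1 & x = p.1 + l * (q.1 - p.1)].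
  have [pq|pq] := eqVneq p.1 q.1.
    have xp : x = p.1 by apply/eqP; rewrite eq_le px pq xq.
    by rewrite /l pq subrr invr0 !mulr0 xp pq addr0.
  have pq0 : 0 < q.1 - p.1.
    by rewrite subr_gt0 lt_neqAle pq (le_trans px xq).
  split; first by rewrite divr_ge0 ?(ltW pq0) // subr_ge0.
    by rewrite ler_pdivrMr // mul1r lerD2r.
  by rewrite /l mulfVK ?gt_eqF // addrC subrK.
(* Stewart's theorem. The subtracted term is nonnegative, so what remains is bounded by a convex
   combination of the two given bounds. *)
have -> : sqdist v (x, p.2 + (q.2 - p.2) * l) =
    (1 - l) * sqdist v p + l * sqdist v q - l * (1 - l) * sqdist p q.
  by rewrite xE /sqdist /=; ring.
move: l l0 l1 xE => l l0 l1 xE.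
have l1' : 0 <= 1 - l by rewrite subr_ge0.
have pq0 : 0 <= sqdist p q by rewrite addr_ge0 ?sqr_ge0.
have := ler_wpM2l l0 vq.
have : (1 - l) * sqdist v p <= (1 - l) * rho.
  exact: ler_wpM2l vp.
have : 0 <= l * (1 - l) * sqdist p q.
  by rewrite !mulr_ge0.
lra.
Qed.

(* If both are above, the lower one has a point of its segment straight below it,
   which is even farther from the other one. *)
Lemma same_side_sqdist p q p' q' u v rho :
  p.1 <= u.1 <= q.1 -> p'.1 <= v.1 <= q'.1 ->
  sqdist u p' <= rho -> sqdist u q' <= rho ->
  sqdist v p <= rho -> sqdist v q <= rho ->
  (seg_height p q u.1 <= u.2) = (seg_height p' q' v.1 <= v.2) ->
  sqdist u v <= rho.
Proof.
move=> hu hv up' uq' vp vq.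
have := sqdist_seg hu vp vq; have := sqdist_seg hv up' uq'.
move: (seg_height p q u.1) (seg_height p' q' v.1) => s s'.
case: u v {hu hv up' uq' vp vq} => [u1 u2] [v1 v2].
(* The lower vertex (the higher one when both are below) and its segment point share the abscissa,
   so only the ordinates are compared: [z] lies between [y] and [t]. *)
have mono (y z t : R) : t <= z <= y \/ y <= z <= t -> (y - z) ^+ 2 <= (y - t) ^+ 2.
  case=> /andP[h1 h2]; last by rewrite -2!(sqrrN (y - _)) !opprB lerXn2r ?nnegrE; lra.
  by rewrite lerXn2r ?nnegrE; lra.
rewrite /sqdist /= => h' h; case: (leP s) => su /esym sv.
- have [uv|/ltW uv] := leP u2 v2.
    by have := mono v2 u2 s; rewrite su uv => /(_ (or_introl isT)); lra.
  by have := mono u2 v2 s'; rewrite sv uv => /(_ (or_introl isT)); lra.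
- have {}sv : v2 < s' by rewrite ltNge sv.
  have [uv|/ltW uv] := leP u2 v2.
    by have := mono u2 v2 s'; rewrite (ltW sv) uv => /(_ (or_intror isT)); lra.
  by have := mono v2 u2 s; rewrite (ltW su) uv => /(_ (or_intror isT)); lra.
Qed.

End Plane.

(** * Matchings: mates, Koenig's bound and augmenting paths *)

Section Konig.
Variable T : finType.
Implicit Types (e : rel T) (F : {set {set T}}) (I S C : {set T}).

Lemma matching_mate_uniq e F u v w : is_matching e F ->
  [set u; v] \in F -> [set u; w] \in F -> v = w.
Proof.
case=> Fe /trivIsetP Ft Fv Fw.
have [E|NE] := eqVneq [set u; v] [set u; w]; last first.
  have /pred0P/(_ u) := Ft _ _ Fv Fw NE.
  by rewrite /= !inE eqxx.
have : v \in [set u; w] by rewrite -E !inE eqxx orbT.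
have : w \in [set u; v] by rewrite E !inE eqxx orbT.
by rewrite !inE => /orP[|]/eqP-> // /orP[|]/eqP.
Qed.

Lemma matching_edge e F u v : symmetric e -> is_matching e F ->
  [set u; v] \in F -> u != v -> e u v.
Proof.
move=> es [/subsetP Fe _] /Fe; rewrite inE.
move=> /existsP[a /existsP[b /andP[eab /eqP E]]].
have : u \in [set a; b] by rewrite -E !inE eqxx.
have : v \in [set a; b] by rewrite -E !inE eqxx orbT.
by rewrite !inE => /orP[|]/eqP-> /orP[|]/eqP->; rewrite ?eqxx // es.
Qed.

Lemma matching_loop e (side : T -> bool) F u : bipartite side e ->
  is_matching e F -> [set u; u] \notin F.
Proof.
move=> [_ eb] [/subsetP Fe _]; apply/negP => /Fe; rewrite inE.
move=> /existsP[a /existsP[b /andP[/eb eab /eqP E]]].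
have : a \in [set u; u] by rewrite E !inE eqxx.
have : b \in [set u; u] by rewrite E !inE eqxx orbT.
by rewrite !inE !orbb => /eqP bu /eqP au; rewrite au bu eqxx in eab.
Qed.

Lemma mem_cover_matching e F u : symmetric e -> is_matching e F ->
  reflect (exists v, [set u; v] \in F) (u \in cover F).
Proof.
move=> es [/subsetP Fe _]; apply: (iffP bigcupP) => [[A FA uA]|[v Fv]].
  move: (Fe _ FA); rewrite inE => /existsP[a /existsP[b /andP[_ /eqP E]]].
  move: uA FA; rewrite E !inE => /orP[|]/eqP-> Fab; first by exists b.
  by exists a; rewrite setUC.
by exists [set u; v] => //; rewrite !inE eqxx.
Qed.

(* Exchanging each vertex of [S] outside [I] for its mate is injective. *)
Lemma card_independent_le e F I C S : symmetric e -> is_matching e F ->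
  {in C, forall u, u \notin I -> exists2 v, v \in I & [set u; v] \in F} ->
  S \subset C -> {in S &, forall u v, u != v -> ~~ e u v} -> (#|S| <= #|I|)%N.
Proof.
move=> es mF mate /subsetP SC indep.
pose phi u := if u \in I then u
  else odflt u [pick v | (v \in I) && ([set u; v] \in F)].
have phiP u : u \in S -> [/\ u \in I & phi u = u] \/
    [/\ u \notin I, phi u \in I & [set u; phi u] \in F].
  move=> uS; rewrite /phi; case: ifPn => uI; first by left.
  right; case: pickP => [v /andP[]//|no].
  by have [v vI vF] := mate u (SC u uS) uI; have := no v; rewrite vI vF.
(* The mate of [u] is adjacent to [u], so the independent set [S] cannot contain both. Hence an
   exchanged vertex never collides with one that [phi] fixes. *)
have notS u : u \in S -> u \notin I -> [set u; phi u] \in F -> phi u \in I ->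
    phi u \notin S.
  move=> uS uI uF pI; have ne : u != phi u by apply: contraNneq uI => ->.
  apply/negP => pS; have := indep _ _ uS pS ne.
  by rewrite (matching_edge es mF uF ne).
have inj : {in S &, injective phi}.
  move=> u v uS vS E.
  case: (phiP u uS) (phiP v vS) => [[uI Eu]|[uI pu uF]] [[vI Ev]|[vI pv vF]].
  - by rewrite -Eu -Ev.
  - by have := notS _ vS vI vF pv; rewrite -E Eu uS.
  - by have := notS _ uS uI uF pu; rewrite E Ev vS.
  - apply: (@matching_mate_uniq e F (phi u)) => //; first by rewrite setUC.
    by rewrite E setUC.
rewrite -(card_in_imset inj); apply/subset_leq_card/subsetP => _ /imsetP[u uS ->].
by case: (phiP u uS) => [[uI ->]|[]].
Qed.

(** An edge followed by a matching edge count as one step, so in a bipartite graph a path stays on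
    the side of its start and the other side remains implicit. *)
Definition alt_step e F : rel T :=
  fun u w => [exists v, e u v && ([set v; w] \in F)].

Lemma edges_pair e u v : e u v -> [set u; v] \in edges e.
Proof.
by move=> euv; rewrite inE; apply/existsP; exists u; apply/existsP; exists v;
  rewrite euv eqxx.
Qed.

Lemma uncoveredP F u A : u \notin cover F -> A \in F -> u \notin A.
Proof. by move=> uF AF; apply: contra uF => uA; apply/bigcupP; exists A. Qed.

Lemma trivIsetU1_uncovered F u v : trivIset F ->
  u \notin cover F -> v \notin cover F ->
  trivIset ([set u; v] |: F).
Proof.
move=> /trivIsetP Ft uF vF.
have dis A : A \in F -> [disjoint [set u; v] & A].
  move=> AF; rewrite disjoints_subset; apply/subsetP => x.
  by rewrite !inE => /orP[]/eqP->; apply: uncoveredP AF.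
apply/trivIsetP => A B; rewrite !in_setU1.
move=> /predU1P[->|AF] /predU1P[->|BF]; rewrite ?eqxx // => ne.
- exact: dis.
- by rewrite disjoint_sym dis.
- exact: Ft.
Qed.

Lemma pair_notin F u v : u \notin cover F -> [set u; v] \notin F.
Proof. by apply: contra => uF; apply/bigcupP; exists [set u; v]; rewrite ?inE ?eqxx. Qed.

Lemma is_matchingU1 e F u v : is_matching e F -> e u v ->
  u \notin cover F -> v \notin cover F ->
  is_matching e ([set u; v] |: F).
Proof.
move=> [Fe Ft] euv uF vF; split; last exact: trivIsetU1_uncovered.
by rewrite subUset sub1set edges_pair.
Qed.

(* Induction on the alternating path: exchanging its first matching edge for
   the edge before it gives another maximum matching, with a shorter path. *)
Lemma no_augmenting_path e (side : T -> bool) F u p v :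
  bipartite side e -> is_max_matching e F ->
  u \notin cover F -> path (alt_step e F) u p -> e (last u p) v ->
  side v != side u -> v \in cover F.
Proof.
(* Without repeated vertices, the matching edges used later on the path differ from the one that is
   exchanged, so they survive in the new matching. *)
move=> [es eb] maxF uF /shortenP[{}p + + _].
elim: p u F maxF uF => [|w p IHp] u F [mF maxF] uF /=.
  move=> _ _ euv _; apply/negPn/negP => vF.
  have := maxF _ (is_matchingU1 mF euv uF vF).
  by rewrite cardsU1 pair_notin // add1n ltnn.
move=> /andP[/existsP[x /andP[eux Fxw]] pth] /and3P[uwp wp up] elv sv.
have exw : e x w.
  apply: (matching_edge es mF (Fxw)); apply: contraTneq (Fxw) => <-.
  exact: (matching_loop _ (conj es eb) mF).
have swu : side w = side u.
  by have := eb _ _ eux; have := eb _ _ exw; case: (side w) (side x) (side u) => [] [] [].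
pose F0 := F :\ [set x; w]; pose F' := [set u; x] |: F0.
have xw : x != w by apply: contraTneq exw => ->; apply/negP => /eb; rewrite eqxx.
have m0 : is_matching e F0.
  split; first by apply: subset_trans mF.1; apply: subsetDl.
  apply/trivIsetP => A B /setD1P[_ AF] /setD1P[_ BF].
  by have /trivIsetP := mF.2; apply.
have cov0 y : y \in cover F0 -> [/\ y \in cover F, y != x & y != w].
  case/bigcupP => A /setD1P[nA AF] yA; have /trivIsetP tF := mF.2.
  have dis := tF _ _ AF Fxw nA; have := disjointFr dis yA.
  rewrite !inE => /negbT; rewrite negb_or => /andP[].
  by split=> //; apply/bigcupP; exists A.
have u0 : u \notin cover F0 by apply: contra uF => /cov0[].
have x0 : x \notin cover F0 by apply/negP => /cov0[_]; rewrite eqxx.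
have m' : is_matching e F' by apply: is_matchingU1.
have cF' : #|F'| = #|F|.
  by rewrite /F' cardsU1 pair_notin // (cardsD1 [set x; w] F) Fxw.
have uw : u != w by move: uwp; rewrite inE negb_or => /andP[].
have w' : w \notin cover F'.
  apply/negP => /bigcupP[A /setU1P[->|AF0] wA].
    by move: wA; rewrite !inE ![w == _]eq_sym (negPf uw) (negPf xw).
  by have /cov0[_ _] : w \in cover F0; [apply/bigcupP; exists A|rewrite eqxx].
have sub a s : {subset s <= p} -> side a = side u -> path (alt_step e F) a s ->
    path (alt_step e F') a s.
  elim: s a => //= b s IHs a sp sa /andP[/existsP[c /andP[eac Fcb]] pbs].
  have bp : b \in p by apply: sp; rewrite inE eqxx.
  have ecb : e c b.
    apply: (matching_edge es mF (Fcb)); apply: contraTneq (Fcb) => <-.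
    exact: (matching_loop _ (conj es eb) mF).
  have sb : side b = side u.
    rewrite -sa; have := eb _ _ eac; have := eb _ _ ecb.
    by case: (side a) (side b) (side c) => [] [] [].
  apply/andP; split; last by apply: IHs pbs => // y ys; rewrite sp // inE ys orbT.
  apply/existsP; exists c; rewrite eac /= !inE Fcb andbT.
  apply/orP; right; apply: contraNneq wp => E.
  have : w \in [set c; b] by rewrite E !inE eqxx orbT.
  rewrite !inE => /orP[]/eqP wE; last by rewrite wE.
  by have := eb _ _ eac; rewrite -wE sa swu eqxx.
(* The exchange frees [w], from which the rest of the path starts. Only [u] is covered by [F'] and
   not by [F], and [v] is not [u] because their sides differ. *)
have : v \in cover F'.
  apply: (IHp w F'); rewrite ?swu //=; last by rewrite wp.
    by split=> // G /maxF; rewrite cF'.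
  exact: sub.
case/bigcupP => A /setU1P[->|AF0] vA; last first.
  by have [] : [/\ v \in cover F, v != x & v != w]
    by apply: cov0; apply/bigcupP; exists A.
move: vA; rewrite !inE => /orP[]/eqP vE; first by rewrite vE eqxx in sv.
by apply/bigcupP; exists [set x; w]; rewrite ?inE ?vE ?eqxx.
Qed.
End Konig.

(** * Hoare logic for the real RAM *)

Arguments upd _ _ _ _ _ _ _ /.

(** A syntactic footprint: for concrete programs membership computes, so most frame conditions below
    are proved by [isT]. *)
Fixpoint iwrites (c : cmd) : seq nat :=
  match c with
  | IStore a _ _ => [:: a]
  | Seq c1 c2 | If _ c1 c2 => iwrites c1 ++ iwrites c2
  | While _ c1 => iwrites c1
  | _ => [::]
  end.

Fixpoint rwrites (c : cmd) : seq nat :=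
  match c with
  | RStore a _ _ => [:: a]
  | Seq c1 c2 | If _ c1 c2 => rwrites c1 ++ rwrites c2
  | While _ c1 => rwrites c1
  | _ => [::]
  end.

Definition var (a : nat) : iexp := ILoad a (ILit 0).
Definition set_var (a : nat) (x : iexp) : cmd := IStore a (ILit 0) x.

Definition for_loop (i b : nat) (body : cmd) : cmd :=
  Seq (set_var i (ILit 0))
    (While (BNot (BILe (var b) (var i)))
      (Seq body (set_var i (IAdd (var i) (ILit 1))))).

Section Hoare.
Variable R : realType.
Implicit Types (st : state R) (c : cmd) (Q : state R -> Prop).

Definition agree (ws rs : seq nat) st st' : Prop :=
  (forall a, a \notin ws -> imem st' a =1 imem st a) /\
  (forall a, a \notin rs -> rmem st' a =1 rmem st a).

Lemma agree_rmem ws st st' : agree ws [::] st st' -> rmem st' = rmem st.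
Proof.
by move=> [_ h]; apply/funext => a; apply/funext => u; rewrite (h a isT).
Qed.

Lemma agree_trans ws rs st1 st2 st3 :
  agree ws rs st1 st2 -> agree ws rs st2 st3 -> agree ws rs st1 st3.
Proof.
move=> [i12 r12] [i23 r23]; split=> a aw x; first by rewrite i23 ?i12.
by rewrite r23 ?r12.
Qed.

Lemma agree_sub ws rs ws' rs' st st' : {subset ws <= ws'} ->
  {subset rs <= rs'} -> agree ws rs st st' -> agree ws' rs' st st'.
Proof.
move=> sw sr [hi hr]; split=> a na; [apply: hi|apply: hr];
  by apply: contra na => ?; [exact: sw || exact: sr].
Qed.

Lemma agree_catl ws rs ws' rs' st st' :
  agree ws rs st st' -> agree (ws ++ ws') (rs ++ rs') st st'.
Proof. by apply: agree_sub => a; rewrite mem_cat => ->. Qed.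

Lemma agree_catr ws rs ws' rs' st st' :
  agree ws rs st st' -> agree (ws' ++ ws) (rs' ++ rs) st st'.
Proof. by apply: agree_sub => a; rewrite mem_cat => ->; rewrite orbT. Qed.

Lemma exec_agree c st st' t :
  exec c st st' t -> agree (iwrites c) (rwrites c) st st'.
Proof.
elim=> {c st st' t} //=.
- move=> st a i x; split=> //= b; rewrite inE => ab y.
  by rewrite /= (negPf ab).
- move=> st a i x; split=> //= b; rewrite inE => ab y.
  by rewrite /= (negPf ab).
- move=> c1 c2 st1 st2 st3 t1 t2 _ h1 _ h2.
  by apply: agree_trans (agree_catl _ _ h1) (agree_catr _ _ h2).
- by move=> b c1 c2 st st' t _ _ /agree_catl.
- by move=> b c1 c2 st st' t _ _ /agree_catr.
- by move=> b c st1 st2 st3 t1 t2 _ _ h1 _; apply: agree_trans.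
Qed.

Lemma exec_gt0 c st st' t : exec c st st' t -> (0 < t)%N.
Proof. by elim=> // c1 c2 st1 st2 st3 t1 t2 _ t1_gt0 _ _; rewrite addn_gt0 t1_gt0. Qed.

(** The rule of consequence, combined with the frame rule: the weaker postcondition may use that
    arrays outside the footprint are unchanged. *)
Lemma halts_le c st b b' Q Q' : halts_within c st b Q -> (b <= b')%N ->
  (forall st', agree (iwrites c) (rwrites c) st st' -> Q st' -> Q' st') ->
  halts_within c st b' Q'.
Proof.
move=> [st' [t [ex tb q]]] bb' QQ'; exists st', t.
by split; [|apply: leq_trans bb'|apply: QQ' q; apply: exec_agree ex].
Qed.

Lemma halts_bound c st b b' Q :
  halts_within c st b Q -> (b <= b')%N -> halts_within c st b' Q.
Proof. by move=> h bb'; apply: halts_le h bb' (fun _ _ => id). Qed.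

Lemma halts_skip st Q : Q st -> halts_within Skip st 1 Q.
Proof. by move=> q; exists st, 1%N; split=> //; constructor. Qed.

Lemma halts_istore a i x st Q :
  Q (State (upd (imem st) a (ieval st i) (ieval st x)) (rmem st)) ->
  halts_within (IStore a i x) st 1 Q.
Proof. by move=> q; eexists; exists 1%N; split; [constructor| |]. Qed.

Lemma halts_seq c1 c2 st b1 b2 Q1 Q : halts_within c1 st b1 Q1 ->
  (forall st1, agree (iwrites c1) (rwrites c1) st st1 -> Q1 st1 ->
    halts_within c2 st1 b2 Q) ->
  halts_within (Seq c1 c2) st (b1 + b2) Q.
Proof.
move=> [st1 [t1 [ex1 tb1 q1]]] h2.
have [st2 [t2 [ex2 tb2 q2]]] := h2 _ (exec_agree ex1) q1.
exists st2, (t1 + t2)%N; split=> //; first exact: ExSeq ex1 ex2.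
exact: leq_add.
Qed.

Lemma halts_istore_seq a i x c st b Q :
  halts_within c (State (upd (imem st) a (ieval st i) (ieval st x)) (rmem st))
    b Q ->
  halts_within (Seq (IStore a i x) c) st b.+1 Q.
Proof.
move=> [st2 [t2 [ex2 tb2 q2]]]; exists st2, (1 + t2)%N; split=> //.
by apply: ExSeq ex2; constructor.
Qed.

Lemma halts_if b c1 c2 st bd Q :
  (beval st b -> halts_within c1 st bd Q) ->
  (~~ beval st b -> halts_within c2 st bd Q) ->
  halts_within (If b c1 c2) st bd.+1 Q.
Proof.
move=> h1 h2; case: (boolP (beval st b)) => hb.
  have [st' [t [ex tb q]]] := h1 hb; exists st', t.+1; split=> //.
  exact: ExIfTrue.
have [st' [t [ex tb q]]] := h2 hb; exists st', t.+1; split=> //.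
exact: ExIfFalse.
Qed.

(** The invariant carries the iteration number and forces exactly [T] iterations. Each pays one step
    for its test, and the failing test pays the final one. *)
Lemma halts_while b c st T cb (Inv : nat -> state R -> Prop) Q :
  Inv 0%N st ->
  (forall j st1, (j < T)%N -> Inv j st1 ->
    beval st1 b /\ halts_within c st1 cb (Inv j.+1)) ->
  (forall st1, Inv T st1 -> ~~ beval st1 b /\ Q st1) ->
  halts_within (While b c) st (T * cb.+1 + 1) Q.
Proof.
move=> I0 step fin.
suff H m j st1 : (j + m = T)%N -> Inv j st1 ->
    halts_within (While b c) st1 (m * cb.+1 + 1) Q by exact: (H T 0%N).
elim: m j st1 => [|m IHm] j st1 jT Ij.
  have [nb q] : ~~ beval st1 b /\ Q st1 by apply: fin; rewrite -jT addn0.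
  by exists st1, 1%N; split=> //; constructor.
have jT' : (j < T)%N by rewrite -jT addnS ltnS leq_addr.
have [hb [st2 [t2 [ex2 tb2 I2]]]] := step _ _ jT' Ij.
have [|st3 [t3 [ex3 tb3 q3]]] := IHm j.+1 st2 _ I2; first by rewrite addSnnS.
exists st3, (t2 + t3).+1; split=> //; first exact: ExWhileTrue ex2 ex3.
by rewrite mulSn -addnA addSn ltnS leq_add.
Qed.

Definition put st (i v : nat) : state R :=
  State (upd (imem st) i 0%N v) (rmem st).

(** The invariant refers to the state after the counter is incremented, hence [put]. An iteration
    costs the test, the body and the increment; the extra [2] is the initialization and the last
    test. *)
Lemma halts_for i b body st m cb (Inv : nat -> state R -> Prop) :
  i \notin iwrites body -> b \notin i :: iwrites body -> imem st b 0%N = m ->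
  Inv 0%N (put st i 0) ->
  (forall j st1, (j < m)%N -> agree (i :: iwrites body) (rwrites body) st st1 ->
     imem st1 i 0%N = j -> Inv j st1 ->
     halts_within body st1 cb (fun st2 => Inv j.+1 (put st2 i j.+1))) ->
  halts_within (for_loop i b body) st (m * cb.+2 + 2) (Inv m).
Proof.
move=> iw bw bm I0 step; rewrite addnS; apply: halts_istore_seq => /=.
pose J j st1 := [/\ agree (i :: iwrites body) (rwrites body) st st1,
  imem st1 i 0%N = j & Inv j st1].
apply: (@halts_while _ _ _ _ _ J); first split=> //=.
- by split=> //= a; rewrite inE negb_or => /andP[/negPf ai _] x; rewrite /= ai.
- by rewrite !eqxx.
- move=> j st1 jm [ag ij Ij]; split.
    by rewrite /= ij ag.1 // bm -ltnNge.
  rewrite -[cb.+1]addn1; apply: halts_seq (step j st1 jm ag ij Ij) _ => st2 ag2 I2.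
  apply: halts_istore; rewrite /= ag2.1 // ij addn1; split=> //.
    apply: agree_trans ag _; split=> a na x /=; last exact: ag2.2.
    move: na; rewrite inE negb_or => /andP[/negPf -> na] /=.
    exact: ag2.1.
  by rewrite /= !eqxx.
- move=> st1 [ag ij Ij]; split=> //.
  by rewrite /= ij ag.1 // bm leqnn.
Qed.

End Hoare.

(** * Relocating a program to higher arrays *)

Section Shift.
Variables (R : realType) (s : nat).
Implicit Types (st : state R) (c : cmd).

Fixpoint iexp_shift (x : iexp) : iexp :=
  match x with
  | ILit c => ILit c
  | ILoad a i => ILoad (s + a) (iexp_shift i)
  | IAdd x y => IAdd (iexp_shift x) (iexp_shift y)
  | ISub x y => ISub (iexp_shift x) (iexp_shift y)
  end.

Fixpoint rexp_shift (x : rexp) : rexp :=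
  match x with
  | RLit c => RLit c
  | RLoad a i => RLoad (s + a) (iexp_shift i)
  | RAdd x y => RAdd (rexp_shift x) (rexp_shift y)
  | RSub x y => RSub (rexp_shift x) (rexp_shift y)
  | RMul x y => RMul (rexp_shift x) (rexp_shift y)
  | RDiv x y => RDiv (rexp_shift x) (rexp_shift y)
  end.

Fixpoint bexp_shift (b : bexp) : bexp :=
  match b with
  | BILe x y => BILe (iexp_shift x) (iexp_shift y)
  | BRLe x y => BRLe (rexp_shift x) (rexp_shift y)
  | BNot b => BNot (bexp_shift b)
  | BAnd b c => BAnd (bexp_shift b) (bexp_shift c)
  end.

Fixpoint cmd_shift (c : cmd) : cmd :=
  match c with
  | Skip => Skip
  | IStore a i x => IStore (s + a) (iexp_shift i) (iexp_shift x)
  | RStore a i x => RStore (s + a) (iexp_shift i) (rexp_shift x)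
  | Seq c1 c2 => Seq (cmd_shift c1) (cmd_shift c2)
  | If b c1 c2 => If (bexp_shift b) (cmd_shift c1) (cmd_shift c2)
  | While b c => While (bexp_shift b) (cmd_shift c)
  end.

(** The memory as the relocated program sees it; relocated runs are simulated step by step, so the
    time does not change. *)
Definition unshift st : state R :=
  State (fun a => imem st (s + a)) (fun a => rmem st (s + a)).

Lemma ieval_shift st x : ieval st (iexp_shift x) = ieval (unshift st) x.
Proof. by elim: x => //= [a i ->|x -> y ->|x -> y ->]. Qed.

Lemma reval_shift st x : reval st (rexp_shift x) = reval (unshift st) x.
Proof.
elim: x => //= [a i|x -> y ->|x -> y ->|x -> y ->|x -> y ->] //.
by rewrite ieval_shift.
Qed.

Lemma beval_shift st b : beval st (bexp_shift b) = beval (unshift st) b.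
Proof.
elim: b => //= [x y|x y|b -> //|b -> c -> //].
  by rewrite !ieval_shift.
by rewrite !reval_shift.
Qed.

Lemma upd_shift (V : Type) (m : nat -> nat -> V) a i v :
  (fun b => upd m (s + a) i v (s + b)) = upd (fun b => m (s + b)) a i v.
Proof. by apply/funext => b; apply/funext => j; rewrite /upd eqn_add2l. Qed.

Lemma exec_shift c st0 st1 t : exec c st0 st1 t -> forall st,
  unshift st = st0 ->
  exists2 st', exec (cmd_shift c) st st' t & unshift st' = st1.
Proof.
elim=> {c st0 st1 t} /=.
- by move=> st0 st <-; exists st => //; constructor.
- move=> st0 a i x st <-; eexists; first exact: ExIStore.
  by rewrite /unshift /= upd_shift !ieval_shift.
- move=> st0 a i x st <-; eexists; first exact: ExRStore.
  by rewrite /unshift /= upd_shift ieval_shift reval_shift.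
- move=> c1 c2 st1 st2 st3 t1 t2 _ h1 _ h2 st /h1[st' ex1 /h2[st'' ex2 E]].
  by exists st'' => //; apply: ExSeq ex1 ex2.
- move=> b c1 c2 st0 st1 t hb _ h st E; have [st' ex E'] := h _ E.
  by exists st' => //; apply: ExIfTrue => //; rewrite beval_shift E.
- move=> b c1 c2 st0 st1 t hb _ h st E; have [st' ex E'] := h _ E.
  by exists st' => //; apply: ExIfFalse => //; rewrite beval_shift E.
- move=> b c st0 hb st E; exists st => //.
  by apply: ExWhileFalse => //; rewrite beval_shift E.
- move=> b c st1 st2 st3 t1 t2 hb _ h1 _ h2 st E.
  have [st' ex1 /h2[st'' ex2 E']] := h1 _ E.
  exists st'' => //; apply: ExWhileTrue ex1 ex2.
  by rewrite beval_shift E.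
Qed.

Lemma halts_shift c st bd Q : halts_within c (unshift st) bd Q ->
  halts_within (cmd_shift c) st bd (fun st' => Q (unshift st')).
Proof.
move=> [st1 [t [ex tb q]]]; have [st' ex' E] := exec_shift ex (erefl _).
by exists st', t; split=> //; rewrite E.
Qed.

(** This protects the variables of the caller although nothing is known about the code of [c]. *)
Lemma iwrites_shift c a : (a < s)%N -> a \notin iwrites (cmd_shift c).
Proof.
move=> sa; elim: c => //= [b _ _|c1 h1 c2 h2|_ c1 h1 c2 h2];
  rewrite ?inE ?mem_cat ?negb_or ?h1 ?h2 //.
by rewrite neq_ltn (leq_trans sa) ?leq_addr.
Qed.

Lemma rwrites_shift c a : (a < s)%N -> a \notin rwrites (cmd_shift c).
Proof.
move=> sa; elim: c => //= [b _ _|c1 h1 c2 h2|_ c1 h1 c2 h2];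
  rewrite ?inE ?mem_cat ?negb_or ?h1 ?h2 //.
by rewrite neq_ltn (leq_trans sa) ?leq_addr.
Qed.

End Shift.

Local Open Scope nat_scope.

(** * Counting the radii *)

(* Integer arrays of the program: 0 input size, 1 best clique so far, 2 number
   of radii, 3 and 4 vertex loops, 5 freshness of a radius, 6 the guessed tuple,
   7 loop on its entries, 8 carry of its increment, 9 candidates, 10 their
   sides, 11 index in the adjacency matrix, 12 marks and 13 queue of the
   alternating search, 14 length of the queue, 15 selected set and 16 its size,
   17 size of the best clique, 18 length of the tuple, 19 to 22 temporaries.
   The matching program runs on the arrays from 32 on. *)
Definition count_radii : cmd :=
  Seq (set_var 2 (ILit 0))
    (for_loop 3 0
      (Seq (set_var 5 (ILit 1))
      (* The bound of this loop is the outer counter: a radius is fresh when no earlier vertex has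
         it. *)
      (Seq (for_loop 4 3
             (If (BAnd (BRLe (RLoad 2 (var 4)) (RLoad 2 (var 3)))
                       (BRLe (RLoad 2 (var 3)) (RLoad 2 (var 4))))
               (set_var 5 (ILit 0)) Skip))
        (set_var 2 (IAdd (var 2) (var 5)))))).

Section RadiusCount.
Variable R : realType.
Implicit Types st : state R.

(** [undup] recurses from the front while the program extends the list at its end, so the last
    element is first moved to the front. *)
Lemma size_undup_rcons (T : eqType) (s : seq T) x :
  size (undup (rcons s x)) = (size (undup s) + (x \notin s))%N.
Proof.
have /perm_size -> : perm_eq (undup (rcons s x)) (undup (x :: s)).
  by apply: perm_undup => y; rewrite mem_rcons.
by rewrite /=; case: (x \in s); rewrite /= ?addn0 ?addn1.
Qed.

Lemma map_iotaS (T : Type) (F : nat -> T) j :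
  [seq F u | u <- iota 0 j.+1] = rcons [seq F u | u <- iota 0 j] (F j).
Proof. by rewrite -addn1 iotaD map_cat add0n cats1. Qed.

Lemma halts_count_radii st n : imem st 0 0 = n ->
  halts_within count_radii st (n * (4 * n + 6) + 3)%N
    (fun st' => imem st' 2 0 = size (undup [seq rmem st 2 u | u <- iota 0 n])).
Proof.
move=> st0; apply: halts_bound.
  apply: halts_istore_seq.
  apply: (@halts_for _ _ _ _ _ n (4 * n + 4) (fun j st' =>
    imem st' 2 0 = size (undup [seq rmem st 2 u | u <- iota 0 j]))) => //.
  move=> i st1 ilt ag1 i1 I1.
  have r1 u : rmem st1 2 u = rmem st 2 u by rewrite (ag1.2 2 isT).
  apply: halts_bound.
    apply: halts_istore_seq; apply: halts_seq.
      apply: (@halts_for _ _ _ _ _ i 2 (fun j st' => imem st' 5 0 =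
        (rmem st 2 i \notin [seq rmem st 2 u | u <- iota 0 j]) :> nat)) => //.
      move=> j st2 jlt ag2 j2 I2; rewrite map_iotaS mem_rcons inE negb_or.
      have r2 u : rmem st2 2 u = rmem st 2 u by rewrite (ag2.2 2 isT) /= r1.
      apply: halts_if; rewrite /= j2 !(ag2.1 3 isT) /= i1 !r2 -eq_le.
        by move=> /eqP E; apply: halts_istore; rewrite /= E eqxx.
      by move=> E; apply: halts_skip; rewrite /= I2 eq_sym E.
    move=> st2 ag2 I2; apply: halts_istore.
    by rewrite map_iotaS size_undup_rcons /= I2 (ag2.1 2 isT) /= I1.
  by lia.
by lia.
Qed.
End RadiusCount.


(** * Candidates of a guess *)

(** Squares are compared because the machine has no square roots; for positive radii this is the
    intersection test. *)
Definition bnear (i j : iexp) : bexp :=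
  let dx := RSub (RLoad 0 i) (RLoad 0 j) in
  let dy := RSub (RLoad 1 i) (RLoad 1 j) in
  let r := RAdd (RLoad 2 i) (RLoad 2 j) in
  BRLe (RAdd (RMul dx dx) (RMul dy dy)) (RMul r r).

Definition breq (x y : rexp) : bexp := BAnd (BRLe x y) (BRLe y x).

Definition bspans (i j u : iexp) : bexp :=
  BAnd (BAnd (breq (RLoad 2 i) (RLoad 2 u)) (breq (RLoad 2 j) (RLoad 2 u)))
    (BAnd (BRLe (RLoad 0 i) (RLoad 0 u)) (BRLe (RLoad 0 u) (RLoad 0 j))).

Definition babove (i j u : iexp) : bexp :=
  BRLe (RAdd (RLoad 1 i)
    (RMul (RSub (RLoad 1 j) (RLoad 1 i))
      (RDiv (RSub (RLoad 0 u) (RLoad 0 i)) (RSub (RLoad 0 j) (RLoad 0 i)))))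
    (RLoad 1 u).

(** Requiring both ends to be candidates isolates all other vertices instead of deleting them. *)
Definition bconflict (i j : iexp) : bexp :=
  BAnd (BAnd (BILe (ILit 1) (ILoad 9 i)) (BILe (ILit 1) (ILoad 9 j)))
    (BNot (bnear i j)).

(** The first [k] entries of the tuple are the guessed left ends, the last [k] the right ends;
    entries [t] and [t + k] form slot [t]. *)
Definition ileft : iexp := ILoad 6 (var 7).
Definition iright : iexp := ILoad 6 (IAdd (var 7) (var 2)).

Definition find_candidates : cmd :=
  for_loop 3 0
    (Seq (set_var 19 (ILit 0))
    (Seq (set_var 20 (ILit 0))
    (* Several slots may span the same vertex; the last one decides its side, and any of them would
       do. *)
    (Seq (for_loop 7 2
      (If (bspans ileft iright (var 3))
        (Seq (set_var 19 (ILit 1))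
          (If (babove ileft iright (var 3))
            (set_var 20 (ILit 1)) (set_var 20 (ILit 0))))
        Skip))
    (Seq (for_loop 7 2
      (If (BAnd (bnear (var 3) ileft) (bnear (var 3) iright))
        Skip (set_var 19 (ILit 0))))
    (Seq (IStore 9 (var 3) (var 19))
      (IStore 10 (var 3) (var 20))))))).

(* Arrays 32, 33, 34 are the arrays 0, 1, 2 of the shifted matching program. *)
Definition setup_matching : cmd :=
  Seq (set_var 32 (var 0))
  (Seq (set_var 11 (ILit 0))
  (for_loop 3 0
    (Seq (IStore 33 (var 3) (ILoad 10 (var 3)))
    (for_loop 4 0
      (Seq (If (bconflict (var 3) (var 4))
             (IStore 34 (var 11) (ILit 1)) (IStore 34 (var 11) (ILit 0)))
        (set_var 11 (IAdd (var 11) (ILit 1)))))))).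

Section Candidates.
Variable R : realType.
Implicit Types (st : state R) (m : nat -> nat -> R).

Definition pt m (u : nat) : R * R := (m 0 u, m 1 u).

Definition near m (u v : nat) : bool :=
  (sqdist (pt m u) (pt m v) <= (m 2%N u + m 2%N v) ^+ 2)%R.

(* Two vertices [i], [j] guessed to be the leftmost and the rightmost one of
   their radius class. *)
Definition spans m (i j u : nat) : bool :=
  [&& m 2 i == m 2 u, m 2 j == m 2 u, (m 0%N i <= m 0%N u)%R & (m 0%N u <= m 0%N j)%R].

Definition above m (i j u : nat) : bool :=
  (seg_height (pt m i) (pt m j) (m 0%N u) <= m 1%N u)%R.

(** No radius is attached to a slot: [spans] reads the radius off the two guessed vertices. A slot
    for a radius absent from the clique can thus hold any vertex of the clique. *)
Definition candidate m (k : nat) (g : nat -> nat) (u : nat) : bool :=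
  has (fun t => spans m (g t) (g (t + k)%N) u) (iota 0 k) &&
  all (fun t => near m u (g t) && near m u (g (t + k)%N)) (iota 0 k).

Lemma beval_near st i j :
  beval st (bnear i j) = near (rmem st) (ieval st i) (ieval st j).
Proof. by []. Qed.

Lemma beval_spans st i j u : beval st (bspans i j u) =
  spans (rmem st) (ieval st i) (ieval st j) (ieval st u).
Proof. by rewrite /= -!eq_le -andbA. Qed.

Lemma beval_above st i j u : beval st (babove i j u) =
  above (rmem st) (ieval st i) (ieval st j) (ieval st u).
Proof. by []. Qed.

Lemma has_iotaS (p : pred nat) j : has p (iota 0 j.+1) = has p (iota 0 j) || p j.
Proof. by rewrite -addn1 iotaD has_cat /= orbF. Qed.

Lemma all_iotaS (p : pred nat) j : all p (iota 0 j.+1) = all p (iota 0 j) && p j.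
Proof. by rewrite -addn1 iotaD all_cat /= andbT. Qed.

Lemma halts_find_candidates st n k : imem st 0 0 = n -> imem st 2 0 = k ->
  let g := imem st 6 in
  halts_within find_candidates st (n * (k * 10 + 12) + 3)%N (fun st' =>
    forall u, (u < n)%N ->
      imem st' 9 u = candidate (rmem st) k g u /\
      exists2 s : bool, imem st' 10 u = s &
        candidate (rmem st) k g u -> exists2 t, (t < k)%N &
          spans (rmem st) (g t) (g (t + k)%N) u /\
          s = above (rmem st) (g t) (g (t + k)%N) u).
Proof.
move=> n0 k0 g.
pose hs i j := has (fun t => spans (rmem st) (g t) (g (t + k)%N) i) (iota 0 j).
pose al i j := all (fun t => near (rmem st) i (g t) &&
  near (rmem st) i (g (t + k)%N)) (iota 0 j).
pose sd i j (s : nat) := exists2 b : bool, s = b & hs i j -> exists2 t, (t < k)%N &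
          spans (rmem st) (g t) (g (t + k)%N) i /\
          b = above (rmem st) (g t) (g (t + k)%N) i.
apply: halts_le; first apply: (@halts_for _ _ _ _ _ n (10 * k + 9)
  (fun j st' => forall u, (u < j)%N ->
      imem st' 9 u = candidate (rmem st) k g u /\ sd u k (imem st' 10 u))) => //.
  move=> i st1 ilt ag1 i1 I1; have m1 := agree_rmem ag1.
  have k0' : imem st1 2 0 = k by rewrite (ag1.1 2 isT).
  apply: halts_bound.
    apply: halts_istore_seq; apply: halts_istore_seq; apply: halts_seq.
      apply: (@halts_for _ _ _ _ _ k 4 (fun j st' =>
        imem st' 19 0 = hs i j :> nat /\ sd i j (imem st' 20 0))) => //=.
        by split=> //; exists false.
      move=> j st2 jlt ag2 j2 [I2 [b I3 J2]]; have m2 := agree_rmem ag2.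
      have E : beval st2 (bspans ileft iright (var 3)) =
          spans (rmem st) (g j) (g (j + k)%N) i.
        rewrite beval_spans /= j2 !(ag2.1 6 isT) (ag2.1 2 isT) (ag2.1 3 isT) m2 /=.
        by rewrite m1 k0' i1 !(ag1.1 6 isT).
      apply: halts_if; rewrite E => sp.
        apply: halts_istore_seq; set st3 := State _ _.
        have A : beval st3 (babove ileft iright (var 3)) =
            above (rmem st) (g j) (g (j + k)%N) i.
          rewrite beval_above /= j2 !(ag2.1 6 isT) (ag2.1 2 isT) (ag2.1 3 isT) m2 /=.
          by rewrite m1 k0' i1 !(ag1.1 6 isT).
        apply: halts_if; rewrite A => ab; apply: halts_istore;
          rewrite /hs /sd /hs has_iotaS sp orbT /=; split=> //.
          by exists true => // _; exists j.
        by exists false => // _; exists j => //; rewrite (negPf ab).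
      apply: halts_bound; first apply: halts_skip => /=; last by [].
      by rewrite /sd /hs has_iotaS (negPf sp) orbF; split=> //; exists b.
    move=> st2 ag2 [I2 J2]; have m2 := agree_rmem ag2; apply: halts_seq.
      apply: (@halts_for _ _ _ _ _ k 2 (fun j st' =>
        imem st' 19 0 = hs i k && al i j :> nat)) => //=.
      - by rewrite (ag2.1 2 isT) /= (ag1.1 2 isT).
      - by rewrite I2 andbT.
      move=> j st3 jlt ag3 j3 I3; have m3 := agree_rmem ag3.
      have E : beval st3 (BAnd (bnear (var 3) ileft) (bnear (var 3) iright)) =
          near (rmem st) i (g j) && near (rmem st) i (g (j + k)%N).
        rewrite -[LHS]/(beval st3 (bnear (var 3) ileft) &&
          beval st3 (bnear (var 3) iright)).
        rewrite !beval_near /= j3 !(ag3.1 6 isT) (ag3.1 2 isT) (ag3.1 3 isT) m3.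
        by rewrite !(ag2.1 6 isT) (ag2.1 2 isT) (ag2.1 3 isT) m2 /=
          m1 k0' i1 !(ag1.1 6 isT).
      apply: halts_if; rewrite E => ne.
        by apply: halts_skip; rewrite /= I3 /al all_iotaS ne andbT.
      by apply: halts_istore; rewrite /= /al all_iotaS (negPf ne) !andbF.
    move=> st3 ag3 I3; apply: halts_istore_seq; apply: halts_istore => u.
    rewrite ltnS leq_eqVlt /= (ag3.1 3 isT) (ag2.1 3 isT) /= i1.
    case: eqP => [-> _|ne /= ui]; rewrite ?eqxx /=.
      by rewrite I3 (ag3.1 20 isT).
    rewrite !(ag3.1 9 isT) !(ag3.1 10 isT) !(ag2.1 9 isT) !(ag2.1 10 isT) /=.
    exact: I1.
  by lia.
- by lia.
move=> st' _ I u un; have [-> [b -> H]] := I u un; split=> //.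
by exists b => // /andP[h _]; apply: H.
Qed.

Definition conflict m (c : nat -> nat) (u v : nat) : bool :=
  [&& 0 < c u, 0 < c v & ~~ near m u v].

Lemma beval_conflict st i j : beval st (bconflict i j) =
  conflict (rmem st) (imem st 9) (ieval st i) (ieval st j).
Proof. by rewrite /conflict andbA -beval_near. Qed.

Lemma halts_setup_matching st n : imem st 0 0 = n ->
  halts_within setup_matching st (n * (n * 5 + 5) + 4) (fun st' =>
    [/\ imem st' 32 0 = n,
      forall u, u < n -> imem st' 33 u = imem st 10 u
    & forall u v, u < n -> v < n ->
        imem st' 34 (u * n + v) = conflict (rmem st) (imem st 9) u v]).
Proof.
(* The cells are filled in increasing order by a running index, so one threshold [w] measures the
   progress through both loops; the row is recovered from the index by division. *)
move=> n0; pose M st' w := forall u v, v < n -> u * n + v < w ->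
  imem st' 34 (u * n + v) = conflict (rmem st) (imem st 9) u v :> nat.
apply: halts_le.
- apply: halts_istore_seq; apply: halts_istore_seq.
  apply: (@halts_for _ _ _ _ _ n (n * 5 + 3) (fun j st' =>
    [/\ imem st' 32 0 = n, imem st' 11 0 = j * n,
      forall u, u < j -> imem st' 33 u = imem st 10 u & M st' (j * n)])) => //.
  move=> i st1 ilt ag1 i1 [I1 J1 K1 L1]; have m1 := agree_rmem ag1.
  have n1 : imem st1 0 0 = n by rewrite (ag1.1 0 isT).
  apply: (halts_bound (b := (n * 5 + 2).+1)); last by rewrite addn3 addn2.
  apply: halts_istore_seq; apply: halts_le.
    apply: (@halts_for _ _ _ _ _ n 3 (fun j st' =>
      imem st' 11 0 = i * n + j /\ M st' (i * n + j))) => //=.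
      by rewrite addn0; split.
    move=> j st2 jlt ag2 j2 [I2 J2]; have m2 := agree_rmem ag2.
    pose b := conflict (rmem st) (imem st 9) i j.
    apply: halts_bound.
      apply: (halts_seq (Q1 := fun st' => imem st' 34 (i * n + j) = b :> nat /\
        forall x, x != i * n + j -> imem st' 34 x = imem st2 34 x)).
        have E : beval st2 (bconflict (var 3) (var 4)) = b.
          rewrite beval_conflict /= j2 (ag2.1 3 isT) /= i1 m2 /= m1 /b /conflict.
          by rewrite !(ag2.1 9 isT) /= !(ag1.1 9 isT).
        apply: halts_if; rewrite E => eb; apply: halts_istore;
          rewrite /= I2 eqxx ?eb ?(negPf eb); by split=> // x /negPf->.
      move=> st3 ag3 [I3 J3]; apply: halts_istore; split=> /=.
        by rewrite (ag3.1 11 isT) I2 addn1 addnS.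
      move=> u v vn; rewrite addnS ltnS leq_eqVlt /=; case: eqP => [E _|/eqP ne /= lt].
        have n_gt0 : 0 < n by apply: leq_trans vn.
        have ui : u = i.
          by have := congr1 (divn^~ n) E; rewrite !divnMDl // !divn_small // !addn0.
        by move: E; rewrite ui => /addnI->.
      by rewrite J3 //; apply: J2.
    by [].
    by [].
  move=> st2 ag2 [I2 J2]; split.
  - by rewrite /= (ag2.1 32 isT).
  - by rewrite /= I2 mulSn addnC.
  - move=> u; rewrite ltnS leq_eqVlt /= (ag2.1 33 isT) /= i1 (ag1.1 10 isT).
    by case: eqP => [->|_ /K1].
  - by rewrite mulSn addnC; apply: J2.
- by lia.
move=> st' _ [I J K L]; split=> // u v un vn; apply: L => //.
apply: leq_trans (_ : u.+1 * n <= _); last by rewrite leq_mul2r un orbT.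
by rewrite mulSn addnC ltn_add2r.
Qed.
End Candidates.

(** * Alternating search *)

Section AlternatingReach.
Variables (n : nat) (side mate : nat -> nat) (conf : nat -> nat -> bool).
Hypothesis conf_side :
  forall u v, u < n -> v < n -> conf u v -> (side u == 0) != (side v == 0).
Hypothesis mateP : forall v w, v < n -> mate v = w.+1 ->
  [/\ w < n, mate w = v.+1 & conf v w].

(** The vertices of side 0 that alternating paths reach from free vertices of side 0, as in Koenig's
    theorem. *)
Inductive reach : nat -> Prop :=
| ReachFree u : u < n -> side u = 0 -> mate u = 0 -> reach u
| ReachStep u v w : reach u -> conf u v -> v < n -> mate v = w.+1 -> reach w.

(** By [reach_right] and [reach_left], a matching edge is marked at both ends or at none. So taking
    marked vertices on side 0 and unmarked ones on the other side picks exactly one end of each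
    matching edge. *)
Record reach_inv (q : seq nat) (z : nat -> nat) : Prop := ReachInv {
  reach_uniq : uniq q;
  reach_mem : forall w, (w \in q) = [&& w < n, side w == 0 & 0 < z w];
  reach_right : forall v w, v < n -> side v != 0 -> 0 < z v ->
    mate v = w.+1 -> 0 < z w;
  reach_left : forall w v, w \in q -> mate w = v.+1 -> 0 < z v;
  reach_sound : forall w, w \in q -> reach w;
  reach_pred : forall v, v < n -> side v != 0 -> 0 < z v ->
    exists2 u, reach u & conf u v;
  reach_free : forall u, u < n -> side u = 0 -> mate u = 0 -> 0 < z u }.

Lemma reach_size q z : reach_inv q z -> size q <= n.
Proof.
move=> [uq mq _ _ _ _ _]; rewrite -(size_iota 0 n); apply: uniq_leq_size => // w.
by rewrite mq mem_iota add0n => /andP[].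
Qed.

Definition mark (z : nat -> nat) (v x : nat) : nat := if x == v then 1 else z x.

Lemma mark_gt0 z v x : 0 < mark z v x = (x == v) || (0 < z x).
Proof. by rewrite /mark; case: eqP. Qed.

Variables (q : seq nat) (z : nat -> nat) (u v : nat).
Hypotheses (inv : reach_inv q z) (uq : u \in q) (vn : v < n) (uv : conf u v).

Lemma right_of_queue : side v != 0.
Proof.
move: (uq); rewrite (reach_mem inv) => /and3P[un su _].
by have := conf_side un vn uv; rewrite su; case: (side v).
Qed.

(** Such a [v] would end an augmenting path. The search tolerates it; maximality of the matching
    excludes it only when the selection is analysed. *)
Lemma reach_inv_free : mate v = 0 -> reach_inv q (mark z v).
Proof.
move=> v0; have sv := right_of_queue; case: inv => uniq_q mem_q rt lf sd pr fr.
split=> //.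
- move=> w; rewrite mem_q mark_gt0; case: (eqVneq w v) => // ->.
  by rewrite (negPf sv) !andbF.
- move=> x w xn sx; rewrite !mark_gt0; case: (eqVneq x v) => [->|_]; first by rewrite v0.
  by move=> /= zx xw; rewrite (rt x w) ?orbT.
- by move=> w x wq wx; rewrite mark_gt0 (lf w x) ?orbT.
- move=> x xn sx; rewrite mark_gt0; case: (eqVneq x v) => [-> _|_]; last exact: pr.
  by exists u => //; apply: sd.
- by move=> x xn sx mx; rewrite mark_gt0 fr ?orbT.
Qed.

Lemma reach_inv_matched w : z v = 0 -> mate v = w.+1 ->
  reach_inv (rcons q w) (mark (mark z v) w).
Proof.
move=> zv vw; have sv := right_of_queue.
have [wn wv vwc] := mateP vn vw; have sw : side w = 0.
  by have := conf_side vn wn vwc; rewrite (negPf sv); case: (side w).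
case: inv => uniq_q mem_q rt lf sd pr fr.
(* Were [w] queued already, its mate [v] would be marked. This is why the program tests the mark of
   [v] only. *)
have wq : w \notin q by apply/negP => /lf/(_ wv); rewrite zv.
have rw : reach w by apply: ReachStep vw => //; [exact: sd uq | exact: uv].
split.
- by rewrite rcons_uniq wq.
- move=> x; rewrite mem_rcons inE mem_q !mark_gt0; case: (eqVneq x w) => [->|_] /=.
    by rewrite wn sw.
  by case: (eqVneq x v) => // ->; rewrite (negPf sv) !andbF.
- move=> x y xn sx; rewrite !mark_gt0 => + xy.
  case: (eqVneq x v) => [xv|_].
    by move: xy; rewrite xv vw => -[->]; rewrite eqxx.
  case: (eqVneq x w) => [xw|_ /= zx]; first by rewrite xw sw eqxx in sx.
  by rewrite (rt x y) ?orbT.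
- move=> x y; rewrite mem_rcons inE !mark_gt0 => /predU1P[->|xq xy].
    by rewrite wv => -[->]; rewrite eqxx orbT.
  by rewrite (lf x y) ?orbT.
- by move=> x; rewrite mem_rcons inE => /predU1P[->//|/sd].
- move=> x xn sx; rewrite !mark_gt0; case: (eqVneq x w) => [xw|_].
    by rewrite xw sw eqxx in sx.
  by case: (eqVneq x v) => [-> _|_ /= /pr]; [exists u => //; apply: sd | apply].
- by move=> x xn sx mx; rewrite !mark_gt0 fr ?orbT.
Qed.

End AlternatingReach.

Definition init_queue : cmd :=
  Seq (set_var 14 (ILit 0))
  (for_loop 3 0
    (If (BAnd (BILe (ILoad 10 (var 3)) (ILit 0)) (BILe (ILoad 35 (var 3)) (ILit 0)))
      (Seq (IStore 12 (var 3) (ILit 1))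
      (Seq (IStore 13 (var 14) (var 3)) (set_var 14 (IAdd (var 14) (ILit 1)))))
      (IStore 12 (var 3) (ILit 0)))).

(** The queue grows while it is read. A fixed number of [n] rounds, idle past its end, suffices
    because its entries are distinct vertices ([reach_size]). *)
Definition process_queue : cmd :=
  for_loop 3 0
    (If (BILe (IAdd (var 3) (ILit 1)) (var 14))
      (Seq (set_var 21 (ILoad 13 (var 3)))
        (for_loop 4 0
          (If (BAnd (bconflict (var 21) (var 4)) (BILe (ILoad 12 (var 4)) (ILit 0)))
            (Seq (IStore 12 (var 4) (ILit 1))
              (If (BILe (ILit 1) (ILoad 35 (var 4)))
                (Seq (set_var 22 (ISub (ILoad 35 (var 4)) (ILit 1)))
                (Seq (IStore 12 (var 22) (ILit 1))
                (Seq (IStore 13 (var 14) (var 22))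
                  (set_var 14 (IAdd (var 14) (ILit 1))))))
                Skip))
            Skip)))
      Skip).

Section Queue.
Variable R : realType.
Implicit Types st : state R.

Definition queue (q : seq nat) st : Prop :=
  imem st 14 0 = size q /\ forall a, a < size q -> imem st 13 a = nth 0 q a.

Lemma queue_rcons q w st st' : queue q st ->
  imem st' 14 0 = (imem st 14 0).+1 ->
  (forall a, imem st' 13 a = if a == imem st 14 0 then w else imem st 13 a) ->
  queue (rcons q w) st'.
Proof.
move=> [sq qa] E F; split; first by rewrite size_rcons E sq.
move=> a; rewrite size_rcons ltnS leq_eqVlt F nth_rcons sq.
case: eqP => [->|_ /= lt]; first by rewrite ltnn.
by rewrite lt qa.
Qed.

Variables (n : nat) (side mate : nat -> nat) (conf : nat -> nat -> bool).
Hypothesis conf_side :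
  forall u v, u < n -> v < n -> conf u v -> (side u == 0) != (side v == 0).
Hypothesis mateP : forall v w, v < n -> mate v = w.+1 ->
  [/\ w < n, mate w = v.+1 & conf v w].

Lemma halts_init_queue st : imem st 0 0 = n -> imem st 10 =1 side ->
  imem st 35 =1 mate ->
  halts_within init_queue st (n * 6 + 3) (fun st' =>
    exists2 q, queue q st' & reach_inv n side mate conf q (imem st' 12)).
Proof.
move=> n0 side0 mate0; pose p u := (side u == 0) && (mate u == 0).
apply: halts_le.
- apply: halts_istore_seq; apply: (@halts_for _ _ _ _ _ n 4 (fun j st' =>
    queue (filter p (iota 0 j)) st' /\ forall u, u < j -> imem st' 12 u = p u)) => //.
  move=> i st1 ilt ag1 i1 [Q1 I1].
  have Ei : filter p (iota 0 i.+1) = if p i then rcons (filter p (iota 0 i)) i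
      else filter p (iota 0 i).
    by rewrite -addn1 iotaD filter_cat /= add0n; case: ifP => _; rewrite ?cats1 ?cats0.
  have E : beval st1 (BAnd (BILe (ILoad 10 (var 3)) (ILit 0))
      (BILe (ILoad 35 (var 3)) (ILit 0))) = p i.
    by rewrite /= i1 (ag1.1 10 isT) (ag1.1 35 isT) /= side0 mate0 !leqn0.
  apply: halts_if; rewrite E => pi.
  - apply: halts_istore_seq; apply: halts_istore_seq; apply: halts_istore.
    rewrite Ei pi; split=> [|u] /=.
      by apply: queue_rcons Q1 _ _ => [|a] /=; rewrite ?addn1 ?i1.
    by rewrite i1 ltnS leq_eqVlt; case: eqP => [->|_ /I1//]; rewrite pi.
  move/negPf: pi => pi; apply: halts_bound; first apply: halts_istore; last by [].
  rewrite Ei pi; split=> // u /=.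
  by rewrite i1 ltnS leq_eqVlt; case: eqP => [->|_ /I1//]; rewrite pi.
- by lia.
move=> st' _ [Q1 I1]; exists (filter p (iota 0 n)) => //.
have memq w : (w \in filter p (iota 0 n)) = p w && (w < n).
  by rewrite mem_filter mem_iota.
split.
- by rewrite filter_uniq ?iota_uniq.
- move=> w; rewrite memq andbC /p; case: ltnP => //= wn; rewrite I1 // lt0b /p.
  by case: eqP.
- by move=> v w vn sv; rewrite I1 // /p (negPf sv).
- by move=> w v; rewrite memq => /andP[/andP[_ /eqP->]].
- by move=> w; rewrite memq => /andP[/andP[/eqP ? /eqP ?] ?]; apply: ReachFree.
- by move=> v vn sv; rewrite I1 // /p (negPf sv).
- by move=> u un su mu; rewrite I1 // /p su mu.
Qed.

Lemma halts_process_queue st q : imem st 0 0 = n -> imem st 35 =1 mate ->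
  (forall u v, conflict (rmem st) (imem st 9) u v = conf u v) ->
  queue q st -> reach_inv n side mate conf q (imem st 12) ->
  halts_within process_queue st (n * (n * 9 + 6) + 2) (fun st' =>
    exists2 q', reach_inv n side mate conf q' (imem st' 12) &
      forall u v, u \in q' -> v < n -> conf u v -> 0 < imem st' 12 v).
Proof.
move=> n0 mate0 conf0 Q0 R0.
(* Progress is counted in queue positions, which do not change when vertices are appended. *)
pose done (q : seq nat) z h := forall a v, a < h -> a < size q -> v < n ->
  conf (nth 0 q a) v -> 0 < z v.
apply: halts_le.
- apply: (@halts_for _ _ _ _ _ n (n * 9 + 4) (fun h st' => exists q,
    [/\ queue q st', reach_inv n side mate conf q (imem st' 12) &
      done q (imem st' 12) h])) => //; first by exists q.
  move=> h st1 hlt ag1 h1 [q1 [Q1 R1 D1]]; have m1 := agree_rmem ag1.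
  rewrite [n * 9 + 4]addnS; apply: halts_if; rewrite /= h1 Q1.1 addn1 => hq.
  + rewrite [n * 9 + 3]addnS; apply: halts_istore_seq; rewrite /= h1 (Q1.2 _ hq).
    set u := nth 0 q1 h; set st1' := State _ _.
    have uq : u \in q1 by apply: mem_nth.
    have n1 : imem st1' 0 0 = n by rewrite /= (ag1.1 0 isT).
    apply: halts_le.
    * apply: (@halts_for _ _ _ _ _ n 7 (fun j st' => exists q,
        [/\ queue q st', reach_inv n side mate conf q (imem st' 12),
          h < size q /\ nth 0 q h = u, done q (imem st' 12) h &
          forall v, v < j -> conf u v -> 0 < imem st' 12 v])) => //.
        by exists q1.
      move=> j st2 jlt ag2 j2 [q2 [Q2 R2 [hq2 hu] D2 E2]].
      have m2 := agree_rmem ag2.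
      have uq2 : u \in q2 by rewrite -hu mem_nth.
      have E : beval st2 (BAnd (bconflict (var 21) (var 4))
          (BILe (ILoad 12 (var 4)) (ILit 0))) =
          conf u j && (imem st2 12 j == 0).
        rewrite -[LHS]/(beval st2 (bconflict (var 21) (var 4)) && _) beval_conflict.
        rewrite /= j2 (ag2.1 21 isT) /= m2 /= m1 -conf0 leqn0; congr (_ && _).
        by rewrite /conflict !(ag2.1 9 isT) /= !(ag1.1 9 isT).
      apply: halts_if; rewrite E; [case/andP=> cuj /eqP zj | move=> nj].
      -- have mj : imem st2 35 j = mate j by rewrite (ag2.1 35 isT) /= (ag1.1 35 isT).
         apply: halts_istore_seq; rewrite /= j2.
         apply: halts_if; rewrite /= j2 mj => mt.
         ++ apply: halts_istore_seq; apply: halts_istore_seq; apply: halts_istore_seq.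
            apply: halts_istore; rewrite /= j2 mj subn1.
            set w := (mate j).-1; have wj : mate j = w.+1 by rewrite prednK.
            exists (rcons q2 w); split.
            ** by apply: queue_rcons Q2 _ _ => [|a] /=; rewrite ?addn1.
            ** apply: (reach_inv_matched conf_side mateP R2 uq2) => //.
            ** by rewrite size_rcons nth_rcons hq2; split=> //; apply: ltnW.
            ** move=> a v ah _ vn; rewrite nth_rcons (ltn_trans ah hq2) /= => cv.
               by do 2?[case: ifP => // _]; apply: (D2 a v) => //; apply: ltn_trans hq2.
            ** move=> v /=; rewrite ltnS leq_eqVlt => vj cv.
               do 2![case: ifP => // /negbT]; move=> vNj _; apply: E2 => //.
               by move: vj; rewrite (negPf vNj).
         ++ have {}mt : mate j = 0 by move: mt; case: (mate j).
            apply: halts_bound; first apply: halts_skip; last by [].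
            exists q2; split=> //=.
            ** exact: (reach_inv_free conf_side R2 uq2).
            ** move=> a v ah aq vn cv.
               by rewrite /=; case: ifP => // _; apply: (D2 a v).
            ** move=> v /=; rewrite ltnS leq_eqVlt => vj cv.
               case: ifP => // vNj; apply: E2 => //.
               by move: vj; rewrite vNj.
      -- apply: halts_bound; first apply: halts_skip; last by [].
         exists q2; split=> //= v; rewrite ltnS leq_eqVlt => /predU1P[->|/E2//] cuj.
         by move: nj; rewrite cuj lt0n.
    * by lia.
    * move=> st2 ag2 [q2 [Q2 R2 [hq2 hu] D2 E2]]; exists q2; split=> //.
      move=> a v; rewrite ltnS leq_eqVlt => /predU1P[->|ah] aq vn.
        by rewrite hu; apply: E2.
      exact: D2.
  + apply: halts_bound; first apply: halts_skip; last by rewrite addnS.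
    exists q1; split=> // a v; rewrite ltnS leq_eqVlt => /predU1P[->|ah] aq vn.
      by rewrite aq in hq.
    exact: D1.
- by lia.
move=> st' _ [q1 [Q1 R1 D1]]; exists q1 => // u v uq vn cuv.
have uq' : index u q1 < size q1 by rewrite index_mem.
apply: (D1 (index u q1)) => //; last by rewrite nth_index.
exact: leq_trans uq' (reach_size R1).
Qed.
End Queue.

(** * Enumeration of the guesses *)

Definition update_best : cmd :=
  Seq (set_var 16 (ILit 0))
  (Seq (for_loop 3 0
    (If (BAnd (BILe (ILit 1) (ILoad 9 (var 3)))
          (BAnd (BNot (BAnd (BILe (ILoad 10 (var 3)) (ILit 0))
                            (BILe (ILoad 12 (var 3)) (ILit 0))))
                (BNot (BAnd (BILe (ILit 1) (ILoad 10 (var 3)))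
                            (BILe (ILit 1) (ILoad 12 (var 3)))))))
      (Seq (IStore 15 (var 3) (ILit 1)) (set_var 16 (IAdd (var 16) (ILit 1))))
      (IStore 15 (var 3) (ILit 0))))
  (If (BILe (var 17) (var 16))
    (Seq (set_var 17 (var 16))
      (for_loop 3 0 (IStore 1 (var 3) (ILoad 15 (var 3)))))
    Skip)).

(** Adds one to a number in base [n] with its lowest digit first. The carry in array 8 that leaves
    the last digit ends the enumeration. *)
Definition increment : cmd :=
  Seq (set_var 8 (ILit 1))
  (for_loop 7 18
    (Seq (IStore 6 (var 7) (IAdd ileft (var 8)))
      (If (BILe (var 0) ileft)
        (Seq (IStore 6 (var 7) (ILit 0)) (set_var 8 (ILit 1)))
        (set_var 8 (ILit 0))))).

Definition reset : cmd :=
  Seq (set_var 17 (ILit 0))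
  (Seq (for_loop 3 0 (IStore 1 (var 3) (ILit 0)))
  (Seq (set_var 18 (IAdd (var 2) (var 2)))
  (Seq (for_loop 7 18 (IStore 6 (var 7) (ILit 0)))
    (set_var 8 (ILit 0))))).

Section Odometer.
Variable R : realType.
Implicit Types st : state R.

(** The complement, among the candidates, of Koenig's vertex cover, which consists of the unreached
    vertices of side 0 and the reached ones of the other side. *)
Definition selected (c side z : nat -> nat) (u : nat) : bool :=
  (0 < c u) && ((side u == 0) == (0 < z u)).

Lemma halts_update_best st n : imem st 0 0 = n ->
  let p := selected (imem st 9) (imem st 10) (imem st 12) in
  let c := count p (iota 0 n) in
  halts_within update_best st (n * 10 + 10) (fun st' =>
    if imem st 17 0 <= c
    then imem st' 17 0 = c /\ forall u, u < n -> imem st' 1 u = p u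
    else imem st' 17 0 = imem st 17 0 /\ imem st' 1 =1 imem st 1).
Proof.
move=> n0 p c; apply: halts_bound.
  apply: halts_istore_seq; apply: halts_seq.
    apply: (@halts_for _ _ _ _ _ n 3 (fun j st' =>
      imem st' 16 0 = count p (iota 0 j) /\
      forall u, u < j -> imem st' 15 u = p u)) => //.
    move=> i st1 ilt ag1 i1 [C1 I1].
    have Ec : count p (iota 0 i.+1) = count p (iota 0 i) + p i.
      by rewrite -addn1 iotaD count_cat /= addn0.
    have E : beval st1 (BAnd (BILe (ILit 1) (ILoad 9 (var 3)))
          (BAnd (BNot (BAnd (BILe (ILoad 10 (var 3)) (ILit 0))
                            (BILe (ILoad 12 (var 3)) (ILit 0))))
                (BNot (BAnd (BILe (ILit 1) (ILoad 10 (var 3)))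
                            (BILe (ILit 1) (ILoad 12 (var 3))))))) = p i.
      rewrite /= i1 (ag1.1 9 isT) (ag1.1 10 isT) (ag1.1 12 isT) /= /p /selected.
      by congr (_ && _); case: (imem st 10 i) (imem st 12 i) => [|?] [|?].
    apply: halts_if; rewrite E Ec => pi.
    - apply: halts_istore_seq; apply: halts_istore; rewrite pi /= C1; split=> // u.
      by rewrite i1 ltnS leq_eqVlt; case: eqP => [->|_ /I1//]; rewrite pi.
    - apply: halts_bound; first apply: halts_istore; last by [].
      rewrite (negPf pi) addn0 /=; split=> // u.
      by rewrite i1 ltnS leq_eqVlt; case: eqP => [->|_ /I1//]; rewrite (negPf pi).
  move=> st1 ag1 [C1 I1]; apply: (halts_if (bd := (n * 3 + 2).+1));
    rewrite /= C1 (ag1.1 17 isT) /=.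
  - move=> le; apply: halts_istore_seq; rewrite /= C1; apply: halts_le.
    + apply: (@halts_for _ _ _ _ _ n 1 (fun j st' =>
        forall u, u < j -> imem st' 1 u = p u)) => //.
        by rewrite /= (ag1.1 0 isT).
      move=> i st2 ilt ag2 i2 I2; apply: halts_istore => u; rewrite /= i2 (ag2.1 15 isT).
      by rewrite ltnS leq_eqVlt; case: eqP => [-> _|_ /I2//]; apply: I1.
    + by [].
    + move=> st' ag' I'; rewrite le; split; last exact: I'.
      by rewrite (ag'.1 17 isT).
  - move=> /negPf nle; apply: halts_bound; first apply: halts_skip.
      by rewrite nle; split; [rewrite (ag1.1 17 isT)|move=> u; rewrite (ag1.1 1 isT)].
    by [].
by lia.
Qed.

Definition value (n K : nat) (g : nat -> nat) : nat := \sum_(t < K) g t * n ^ t.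

Lemma valueS n K g : value n K.+1 g = value n K g + g K * n ^ K.
Proof. by rewrite /value big_ord_recr. Qed.

Lemma eq_value n K g h : (forall t, t < K -> g t = h t) -> value n K g = value n K h.
Proof. by move=> gh; apply: eq_bigr => t _; rewrite gh. Qed.

Lemma value_lt n K g : (forall t, t < K -> g t < n) -> value n K g < n ^ K.
Proof.
elim: K => [|K IH] gn; first by rewrite /value big_ord0.
rewrite valueS expnS; have := gn K (ltnSn K).
have := IH (fun t tK => gn t (ltnW tK)); nia.
Qed.

Lemma value_inj n K g h : (forall t, t < K -> g t < n) ->
  (forall t, t < K -> h t < n) -> value n K g = value n K h ->
  forall t, t < K -> g t = h t.
Proof.
elim: K => // K IH gn hn; rewrite !valueS => E.
have gn' t : t < K -> g t < n by move=> /ltnW/gn.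
have hn' t : t < K -> h t < n by move=> /ltnW/hn.
have lg := value_lt gn'; have lh := value_lt hn'.
have gt0 : 0 < n ^ K by apply: leq_trans lg.
have EK : g K = h K.
  have := congr1 (divn^~ (n ^ K)) E.
  by rewrite !divnDMl // !divn_small.
move=> t; rewrite ltnS leq_eqVlt => /predU1P[->//|]; apply: IH => //.
by move: E; rewrite EK => /addIn.
Qed.

(** Counting the carry as a digit of weight [n ^ K] makes the equation hold even at overflow, so
    value and carry together give the number of completed rounds. *)
Lemma halts_increment st n K : imem st 0 0 = n -> imem st 18 0 = K ->
  (forall t, t < K -> imem st 6 t < n) ->
  halts_within increment st (K * 6 + 3) (fun st' =>
    [/\ imem st' 8 0 <= 1, forall t, t < K -> imem st' 6 t < n &
      value n K (imem st' 6) + imem st' 8 0 * n ^ K =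
        (value n K (imem st 6)).+1]).
Proof.
move=> n0 K0 gn; apply: halts_le.
- apply: halts_istore_seq; apply: (@halts_for _ _ _ _ _ K 4 (fun j st' =>
    [/\ imem st' 8 0 <= 1, forall t, t < j -> imem st' 6 t < n,
      forall t, j <= t -> imem st' 6 t = imem st 6 t &
      value n j (imem st' 6) + imem st' 8 0 * n ^ j =
        (value n j (imem st 6)).+1])) => //.
    by split=> //=; rewrite /value !big_ord0.
  move=> i st1 ilt ag1 i1 [c1 G1 H1 V1].
  have n1 : imem st1 0 0 = n by rewrite (ag1.1 0 isT).
  have gi := gn i ilt.
  (* Reduces both branches, with and without carry, to an equation about digit [i] alone. *)
  have step st' : (forall t, t != i -> imem st' 6 t = imem st1 6 t) ->
      imem st' 8 0 <= 1 -> imem st' 6 i < n ->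
      imem st' 6 i + imem st' 8 0 * n = imem st 6 i + imem st1 8 0 ->
    [/\ imem st' 8 0 <= 1, forall t, t < i.+1 -> imem st' 6 t < n,
      forall t, i.+1 <= t -> imem st' 6 t = imem st 6 t &
      value n i.+1 (imem st' 6) + imem st' 8 0 * n ^ i.+1 =
        (value n i.+1 (imem st 6)).+1].
    move=> ot c' lt E; split=> //.
    - move=> t; rewrite ltnS leq_eqVlt => /predU1P[->//|ti].
      by rewrite ot ?G1 // neq_ltn ti.
    - by move=> t it; rewrite ot ?H1 ?(ltnW it) // neq_ltn it orbT.
    - rewrite !valueS (@eq_value n i (imem st' 6) (imem st1 6)); last first.
        by move=> t ti; rewrite ot // neq_ltn ti.
      rewrite expnS -addSn -V1 -addnA mulnA -mulnDl E.
      by rewrite mulnDl; lia.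
  apply: halts_bound.
    apply: halts_istore_seq; rewrite /= i1 H1 //; apply: halts_if;
      rewrite /= i1 !eqxx n1 => le.
    - apply: halts_istore_seq; apply: halts_istore; apply: step => /=;
        rewrite ?i1 ?eqxx //.
      + by move=> t /negPf->.
      + exact: leq_ltn_trans gi.
      + by move: le c1 gi; lia.
    - apply: halts_bound; first apply: halts_istore; last by [].
      apply: step => /=; rewrite ?i1 ?eqxx //.
      + by move=> t /negPf->.
      + by rewrite ltnNge.
      + by rewrite addn0.
  by [].
- by lia.
by move=> st' _ [c1 G1 _ V1].
Qed.

Lemma halts_reset st n k : imem st 0 0 = n -> imem st 2 0 = k ->
  halts_within reset st (n * 3 + k * 6 + 10) (fun st' =>
    [/\ imem st' 17 0 = 0, forall u, u < n -> imem st' 1 u = 0,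
      imem st' 18 0 = 2 * k, forall t, t < 2 * k -> imem st' 6 t = 0
      & imem st' 8 0 = 0]).
Proof.
move=> n0 k0; apply: halts_bound.
  apply: halts_istore_seq; apply: halts_seq.
    apply: (@halts_for _ _ _ _ _ n 1 (fun j st' =>
      forall u, u < j -> imem st' 1 u = 0)) => //.
    move=> i st1 ilt ag1 i1 I1; apply: halts_istore => u /=.
    by rewrite i1 ltnS leq_eqVlt; case: ifP => // _ /I1.
  move=> st1 ag1 I1; apply: halts_istore_seq => /=; rewrite (ag1.1 2 isT) /= k0.
  apply: halts_seq.
    apply: (@halts_for _ _ _ _ _ (k + k) 1 (fun j st' =>
      forall u, u < j -> imem st' 6 u = 0)) => //.
    move=> i st2 ilt ag2 i2 I2; apply: halts_istore => u /=.
    by rewrite i2 ltnS leq_eqVlt; case: ifP => // _ /I2.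
  move=> st2 ag2 I2; apply: halts_istore; rewrite mul2n -addnn; split=> //=.
  - by rewrite (ag2.1 17 isT) /= (ag1.1 17 isT).
  - by move=> u un; rewrite (ag2.1 1 isT) /= I1.
  - by rewrite (ag2.1 18 isT).
by lia.
Qed.
End Odometer.

(** * Correctness *)

Section Selection.
Variables (n : nat) (c sd mate z : nat -> nat) (conf : nat -> nat -> bool).
Variables (F : {set {set 'I_n}}) (q : seq nat).
Let side (u : 'I_n) : bool := sd u != 0.
Let e : rel 'I_n := fun u v => conf u v.
Let I : {set 'I_n} := [set u : 'I_n | selected c sd z u].

Hypothesis bip : bipartite side e.
Hypothesis maxF : is_max_matching e F.
Hypothesis mate_in : forall u v : 'I_n, [set u; v] \in F -> mate u = v.+1.
Hypothesis mate_out : forall u : 'I_n, u \notin cover F -> mate u = 0.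
Hypothesis conf_c : forall u v, conf u v -> 0 < c v.

Lemma conf_side u v : u < n -> v < n -> conf u v -> (sd u == 0) != (sd v == 0).
Proof.
move=> un vn; case: bip => _ /(_ (Ordinal un) (Ordinal vn)) /= sides /sides.
by rewrite /side /=; do 2?case: (_ == 0).
Qed.

Lemma mate_pair (v : 'I_n) w : mate v = w.+1 ->
  exists2 w' : 'I_n, w = w' & [set v; w'] \in F.
Proof.
move=> vw; have [vF|/mate_out] := boolP (v \in cover F); last by rewrite vw.
have [w' Fvw'] := mem_cover_matching v bip.1 maxF.1 vF.
by exists w' => //; have := mate_in Fvw'; rewrite vw => -[].
Qed.

Lemma mateP v w : v < n -> mate v = w.+1 ->
  [/\ w < n, mate w = v.+1 & conf v w].
Proof.
move=> vn vw; have [w' -> Fvw] := mate_pair (v := Ordinal vn) vw.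
split=> //; first by apply: (@mate_in w' (Ordinal vn)); rewrite setUC.
apply: (matching_edge bip.1 maxF.1 Fvw); apply: contraTneq (Fvw) => <-.
exact: matching_loop bip maxF.1.
Qed.

Hypothesis inv : reach_inv n sd mate conf q z.
Hypothesis closed : forall u v, u \in q -> v < n -> conf u v -> 0 < z v.

(** Turns the search relation into a path to which [no_augmenting_path] applies. *)
Lemma reach_path w : reach n sd mate conf w -> exists (u : 'I_n) p,
  [/\ u \notin cover F, sd u = 0, sd w = 0, path (alt_step e F) u p
    & w = last u p].
Proof.
elim=> {w} [u un su mu|u v w _ [u0 [p [u0F s0 su pth uE]]] uv vn vw].
  exists (Ordinal un), [::]; split=> //.
  apply/negP => uF; have [w Fw] := mem_cover_matching (Ordinal un) bip.1 maxF.1 uF.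
  by have := mate_in Fw; rewrite /= mu.
have [wn _ cvw] := mateP vn vw.
have [w' ww' Fvw] := mate_pair (v := Ordinal vn) vw.
exists u0, (rcons p w'); rewrite last_rcons rcons_path pth; split=> //.
  have := conf_side _ vn uv; rewrite [in u < n]uE ltn_ord => /(_ isT).
  have := conf_side vn wn cvw.
  by rewrite su; case: (sd v) (sd w) => [|?] [|?].
by apply/existsP; exists (Ordinal vn); rewrite Fvw andbT /e -uE.
Qed.

(** A selected vertex of side 0 is marked, hence queued, so all its neighbours are marked; being on
    the other side, they are not selected. *)
Lemma selected_independent : {in I &, forall u v, ~~ e u v}.
Proof.
have H (u v : 'I_n) : u \in I -> v \in I -> sd u = 0 -> ~~ conf u v.
  rewrite !inE => /andP[_ /eqP zu] /andP[_ /eqP zv] su; apply/negP => uv.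
  have sv : (sd v == 0) = false.
    by have := conf_side (ltn_ord u) (ltn_ord v) uv; rewrite su; case: (sd v).
  have uq : val u \in q by rewrite (reach_mem inv) ltn_ord su -zu su.
  by have := closed uq (ltn_ord v) uv; rewrite -zv sv.
move=> u v uI vI; have [su|su] := eqVneq (sd u) 0; first exact: H.
have [sv|sv] := eqVneq (sd v) 0; first by rewrite bip.1; apply: H.
apply/negP => uv; have := conf_side (ltn_ord u) (ltn_ord v) uv.
by rewrite (negPf su) (negPf sv).
Qed.

(** By [card_independent_le] it is enough that each unselected candidate has a selected mate. On
    side 0 such a candidate is unmarked, hence not free; on the other side it is marked. *)
Lemma selected_max (S : {set 'I_n}) : {in S, forall u : 'I_n, 0 < c u} ->
  {in S &, forall u v, u != v -> ~~ e u v} -> #|S| <= #|I|.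
Proof.
move=> Sc Sind; apply: (@card_independent_le _ e F I [set u : 'I_n | 0 < c u]) => //.
- exact: bip.1.
- exact: maxF.1.
- move=> u; rewrite !inE /selected => cu; rewrite cu /= => uI.
  have [su|su] := eqVneq (sd u) 0.
    have zu : z u = 0 by move: uI; rewrite su; case: (z u).
    case mu : (mate u) => [|v].
      by have := reach_free inv (ltn_ord u) su mu; rewrite zu.
    have [v' vE Fuv] := mate_pair mu; exists v' => //.
    have [vn mv uv] := mateP (ltn_ord u) mu.
    have sv : (sd v == 0) = false.
      by have := conf_side (ltn_ord u) vn uv; rewrite su; case: (sd v).
    rewrite inE /selected -vE (conf_c uv) sv /= eq_sym eqbF_neg -eqn0Ngt.
    apply/eqP; case zv : (z v) => [//|x].
    by have := reach_right inv vn (negbT sv) _ mv; rewrite zv zu => /(_ isT).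
  (* A marked vertex on this side ends an alternating path from a free vertex, so by maximality of
     the matching it is covered. *)
  have zu : 0 < z u by move: uI; rewrite (negPf su); case: (z u).
  have [w rw wu] := reach_pred inv (ltn_ord u) su zu.
  have [u0 [p [u0F s0 sw pth wE]]] := reach_path rw.
  have uF : u \in cover F.
    apply: (no_augmenting_path bip maxF u0F pth); first by rewrite /e -wE.
    by rewrite /side s0 su.
  have [v Fuv] := mem_cover_matching u bip.1 maxF.1 uF.
  exists v => //; have mu := mate_in Fuv.
  have [vn _ uv] := mateP (ltn_ord u) mu.
  have sv : sd v = 0.
    by have := conf_side (ltn_ord u) vn uv; rewrite (negPf su); case: (sd v).
  by rewrite inE /selected (conf_c uv) sv (reach_right inv (ltn_ord u) su zu mu).
- by apply/subsetP => u uS; rewrite inE Sc.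
Qed.

End Selection.

(** * Candidates and cliques of the disk graph *)

Section DiskGeometry.
Variable R : realType.
Implicit Types (m : nat -> nat -> R) (g c sd : nat -> nat).

Lemma near_sym m u v : near m u v = near m v u.
Proof. by rewrite /near sqdistC addrC. Qed.

Lemma near_refl m u : near m u u.
Proof. by rewrite /near /sqdist !subrr expr0n addr0 sqr_ge0. Qed.

Lemma near_ext m m' u v : (forall a x, a < 3 -> m a x = m' a x) ->
  near m u v = near m' u v.
Proof. by move=> E; rewrite /near /pt !E. Qed.

(** Only the three input arrays are sure to survive the matching program, and the enumeration fixes
    only the first [2 * k] entries of a guess. *)
Lemma candidate_ext m m' k g g' u : (forall a x, a < 3 -> m a x = m' a x) ->
  (forall t, t < 2 * k -> g t = g' t) ->
  candidate m k g u = candidate m' k g' u.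
Proof.
move=> E G; have gt t : t \in iota 0 k -> g t = g' t /\ g (t + k) = g' (t + k).
  by rewrite mem_iota => /andP[_ tk]; split; apply: G; lia.
congr (_ && _).
  by apply: eq_in_has => t /gt[-> ->]; rewrite /spans !E.
by apply: eq_in_all => t /gt[-> ->]; rewrite !(near_ext _ _ E).
Qed.

(** Each of two candidates meets both ends of the slot spanning the other, and these ends have the
    radius of the vertex they span. So all four bounds in [same_side_sqdist] are the squared sum of
    the radii of the two candidates. *)
Lemma conflict_bipartite m k g c sd n :
  (forall u, u < n -> c u = candidate m k g u /\
    exists2 s : bool, sd u = s & candidate m k g u -> exists2 t, t < k &
      spans m (g t) (g (t + k)) u /\ s = above m (g t) (g (t + k)) u) ->
  bipartite (fun u : 'I_n => sd u != 0) (fun u v : 'I_n => conflict m c u v).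
Proof.
move=> H; split=> [u v|u v /and3P[cu cv]]; first by rewrite /conflict near_sym andbCA.
apply: contraNneq => E.
have [cE [su suE Hu]] := H u (ltn_ord u); rewrite cE lt0b in cu.
have [cE' [sv svE Hv]] := H v (ltn_ord v); rewrite cE' lt0b in cv.
have [t tk [/and4P[/eqP rt /eqP rt' xt xt'] aE]] := Hu cu.
have [t2 tk2 [/and4P[/eqP rt2 /eqP rt2' xt2 xt2'] aE2]] := Hv cv.
have /andP[_ /allP nu] := cu; have /andP[_ /allP nv] := cv.
have /andP[u1 u2] := nu t2 ltac:(by rewrite mem_iota).
have /andP[v1 v2] := nv t ltac:(by rewrite mem_iota).
apply: (@same_side_sqdist _ (pt m (g t)) (pt m (g (t + k)))
  (pt m (g t2)) (pt m (g (t2 + k)))) => /=.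
- by rewrite xt xt'.
- by rewrite xt2 xt2'.
- by rewrite -rt2.
- by rewrite -rt2'.
- by rewrite -[X in (X + _)%R]rt addrC.
- by rewrite -[X in (X + _)%R]rt' addrC.
- move: E; rewrite suE svE aE aE2 /above /=.
  by do 2!case: (_ <= _)%R.
Qed.

Variables (n : nat) (d : 'I_n -> disk R) (m : nat -> nat -> R).
Hypothesis radius_gt0 : forall i, (0 < radius (d i))%R.
Hypothesis mE : forall i : 'I_n, [/\ m 0 i = (center (d i)).1,
  m 1 i = (center (d i)).2 & m 2 i = radius (d i)].

Lemma nearE (u v : 'I_n) : near m u v = `[< disks_meet (d u) (d v) >].
Proof.
have [xu yu ru] := mE u; have [xv yv rv] := mE v.
have -> : near m u v = (edist (center (d u)) (center (d v)) <=
    radius (d u) + radius (d v))%R.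
  rewrite edist_le ?addr_ge0 ?(ltW (radius_gt0 _)) //.
  by rewrite /near /sqdist /= xu yu ru xv yv rv.
apply/idP/asboolP => h; first exact/(disks_meetE (radius_gt0 u) (radius_gt0 v)).
exact/(disks_meetE (radius_gt0 u) (radius_gt0 v)).
Qed.

Lemma cliqueP (K : {set 'I_n}) :
  is_clique (disk_graph d) K <-> {in K &, forall u v : 'I_n, near m u v}.
Proof.
split=> H u v uK vK.
  have [->|uv] := eqVneq u v; first exact: near_refl.
  by have := H u v uK vK uv; rewrite /disk_graph uv nearE.
by move=> uv; rewrite /disk_graph uv -nearE H.
Qed.

Lemma extremal_pair (K : {set 'I_n}) (r : R) (u0 : 'I_n) : u0 \in K ->
  exists pq : 'I_n * 'I_n, [/\ pq.1 \in K, pq.2 \in K &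
    forall u : 'I_n, u \in K -> m 2 u = r -> spans m pq.1 pq.2 u].
Proof.
move=> u0K; have [u1 /andP[u1K /eqP r1]|no] :=
    pickP (fun u : 'I_n => (u \in K) && (m 2 u == r)); last first.
  by exists (u0, u0); split=> // u uK /eqP ru; have := no u; rewrite uK ru.
pose P (u : 'I_n) := (u \in K) && (m 2 u == r).
have Pu1 : P u1 by rewrite /P u1K r1 eqxx.
have [p /andP[pK /eqP rp] pmin] := @arg_minP _ _ _ u1 P (fun u : 'I_n => m 0 u) Pu1.
have [q /andP[qK /eqP rq] qmax] := @arg_maxP _ _ _ u1 P (fun u : 'I_n => m 0 u) Pu1.
exists (p, q); split=> // u uK ru.
have Pu : P u by rewrite /P uK ru eqxx.
by rewrite /spans rp rq ru eqxx pmin //=; apply: qmax.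
Qed.

(** Slot [t] holds the extremal vertices for the radius at position [t] among the distinct ones. All
    guessed vertices belong to [K], so every vertex of [K] meets them. *)
Lemma clique_candidates (K : {set 'I_n}) : 0 < n -> is_clique (disk_graph d) K ->
  exists2 g : nat -> nat, (forall t, g t < n) &
    forall u : 'I_n, u \in K -> candidate m (num_radii d) g u.
Proof.
move=> n0 /cliqueP cl; have [->|[u0 u0K]] := set_0Vmem K.
  by exists (fun=> 0) => // u; rewrite inE.
pose rs := undup [seq radius (d i) | i <- enum 'I_n].
have [pq pqP] := choice (fun t => extremal_pair (nth 0%R rs t) u0K).
pose k := num_radii d.
pose g t : nat := if t < k then (pq t).1 else (pq (t - k)).2.
have gl t : t < k -> g t = (pq t).1 by rewrite /g => ->.
have gr t : g (t + k) = (pq t).2 by rewrite /g ltnNge leq_addl addnK.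
exists g => [t|u uK]; first by rewrite /g; case: ifP.
apply/andP; split.
  have [_ _ ru] := mE u.
  have urs : radius (d u) \in rs by rewrite mem_undup map_f // mem_enum.
  apply/hasP; exists (index (radius (d u)) rs); first by rewrite mem_iota index_mem.
  rewrite gr gl ?index_mem //; have [_ _] := pqP (index (radius (d u)) rs).
  by apply=> //; rewrite nth_index.
apply/allP => t; rewrite mem_iota => /andP[_ tk]; rewrite gr gl //.
by have [pK qK _] := pqP t; rewrite !cl.
Qed.

End DiskGeometry.

(** * The whole algorithm and its running time *)

Definition round (M : cmd) : cmd :=
  Seq find_candidates
  (Seq setup_matching
  (Seq (cmd_shift 32 M)
  (Seq init_queue
  (Seq process_queue update_best)))).

Definition max_clique (M : cmd) : cmd :=
  Seq count_radii
  (Seq reset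
    (While (BILe (var 8) (ILit 0)) (Seq (round M) increment))).

Section MaxClique.
Variables (R : realType) (n : nat) (d : 'I_n -> disk R) (M : cmd) (fn : nat).
Implicit Types st : state R.
Hypothesis radius_gt0 : forall i, (0 < radius (d i))%R.
Hypothesis matchingM : forall side e st, bipartite side e ->
  @bipartite_input R n side e st ->
  halts_within M st fn (fun st' =>
    exists F, is_max_matching e F /\ matching_output F st').

Definition best st : nat := imem st 17 0.

Definition best_valid st : Prop := exists K : {set 'I_n},
  [/\ is_clique (disk_graph d) K, best st = #|K| & subset_output K st].

Lemma halts_round st k : imem st 0 0 = n -> imem st 2 0 = k ->
  (forall i : 'I_n, [/\ rmem st 0 i = (center (d i)).1,
     rmem st 1 i = (center (d i)).2 & rmem st 2 i = radius (d i)]) ->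
  best_valid st ->
  halts_within (round M) st
    (n * (k * 10 + 12) + n * (n * 14 + 27) + 22 + fn) (fun st' =>
    [/\ best_valid st', best st <= best st' &
      forall K : {set 'I_n}, is_clique (disk_graph d) K ->
        (forall u : 'I_n, u \in K -> candidate (rmem st) k (imem st 6) u) ->
        #|K| <= best st']).
Proof.
move=> n0 k0 mE [B [Bcl Bsz Bout]].
apply: halts_bound.
  apply: halts_seq (halts_find_candidates n0 k0) _ => st1 ag1 H1.
  have m1 := agree_rmem ag1.
  have n1 : imem st1 0 0 = n by rewrite (ag1.1 0 isT).
  have bip := conflict_bipartite H1.
  set c := imem st1 9 in H1 bip; set sd := imem st1 10 in H1 bip.
  apply: halts_seq (halts_setup_matching n1) _ => st2 ag2 [in2 side2 adj2].
  have m2 := agree_rmem ag2.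
  apply: halts_seq.
    apply: halts_shift; apply: (matchingM bip); split=> /=.
    - exact: in2.
    - move=> u; rewrite (side2 u (ltn_ord u)) -/sd.
      by have [_ [[] ->]] := H1 u (ltn_ord u).
    - by move=> u v; rewrite adj2 // m1.
  move=> st3 ag3 [F [maxF [mate_in mate_out]]].
  have fi3 a : a < 32 -> imem st3 a =1 imem st2 a.
    by move=> a32; apply: ag3.1; apply: iwrites_shift.
  have fr3 a x : a < 3 -> rmem st3 a x = rmem st a x.
    by move=> a3; rewrite -m1 -m2; apply: ag3.2; apply: rwrites_shift; lia.
  set mate := imem (unshift 32 st3) 3.
  have n3 : imem st3 0 0 = n by rewrite fi3 // (ag2.1 0 isT).
  have sd3 : imem st3 10 =1 sd by move=> u; rewrite fi3 // (ag2.1 10 isT).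
  pose conf := conflict (rmem st) c.
  have conf_c u v : conf u v -> 0 < c v by case/and3P.
  have cs := conf_side bip.
  have mp := mateP bip maxF mate_in mate_out.
  apply: halts_seq (halts_init_queue conf n3 sd3 (frefl _)) _ => st4 ag4 [q0 Q0 R0].
  have m4 := agree_rmem ag4.
  apply: halts_seq.
    apply: (halts_process_queue (n := n) (side := sd) (mate := mate) (conf := conf)
      cs mp _ _ _ Q0 R0).
    - by rewrite (ag4.1 0 isT).
    - by move=> u; rewrite (ag4.1 35 isT).
    - move=> u v; rewrite /conf /conflict !(ag4.1 9 isT) !fi3 // !(ag2.1 9 isT).
      by rewrite (near_ext (m' := rmem st)) // => a x a3; rewrite m4 fr3.
  move=> st5 ag5 [q1 R1 closed1].
  have n5 : imem st5 0 0 = n by rewrite (ag5.1 0 isT) (ag4.1 0 isT).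
  apply: halts_le (halts_update_best n5) (leqnn _) _ => st6 _.
  have c5 : imem st5 9 =1 c.
    by move=> u; rewrite (ag5.1 9 isT) (ag4.1 9 isT) fi3 // (ag2.1 9 isT).
  have sd5 : imem st5 10 =1 sd.
    by move=> u; rewrite (ag5.1 10 isT) (ag4.1 10 isT) sd3.
  have b5 : imem st5 17 0 = best st.
    by rewrite (ag5.1 17 isT) (ag4.1 17 isT) fi3 // (ag2.1 17 isT) (ag1.1 17 isT).
  have o5 : imem st5 1 =1 imem st 1.
    by move=> u; rewrite (ag5.1 1 isT) (ag4.1 1 isT) fi3 // (ag2.1 1 isT) (ag1.1 1 isT).
  set p := selected _ _ _; have pE : p =1 selected c sd (imem st5 12).
    by move=> u; rewrite /p /selected c5 sd5.
  pose I := [set u : 'I_n | selected c sd (imem st5 12) u].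
  have cI : count p (iota 0 n) = #|I|.
    rewrite cardE /enum_mem size_filter -enumT -val_enum_ord count_map.
    by apply: eq_count => u; rewrite /= pE inE.
  rewrite cI b5 => step.
  have ind := selected_independent bip R1 closed1.
  have Icl : is_clique (disk_graph d) I.
    apply/(cliqueP radius_gt0 mE) => u v uI vI; have := ind c u v uI vI.
    move: uI vI; rewrite !inE => /andP[cu _] /andP[cv _].
    by rewrite /conflict cu cv /= negbK.
  have maxI (K : {set 'I_n}) : is_clique (disk_graph d) K ->
      (forall u : 'I_n, u \in K -> candidate (rmem st) k (imem st 6) u) ->
      #|K| <= #|I|.
    move=> /(cliqueP radius_gt0 mE) cl cand.
    apply: (selected_max bip maxF mate_in mate_out conf_c R1) => [u uK|u v uK vK _].
      by have [-> _] := H1 u (ltn_ord u); rewrite cand.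
    by rewrite /conf /conflict cl // !andbF.
  case: leqP step => [le [bE out]|lt [bE out]].
  - split; [exists I; split=> // | by rewrite /best bE | by rewrite /best bE].
    by move=> u; rewrite out // pE inE.
  - split; [exists B; split=> // | by rewrite /best bE | ].
    + by rewrite /best bE.
    + by move=> u; rewrite out o5.
    + move=> K Kcl Kc; rewrite /best bE; apply: leq_trans (ltnW lt).
      exact: maxI.
by lia.
Qed.

(** These arrays hold the state of the enumeration: size, number of radii, tuple, carry and tuple
    length. *)
Lemma round_iwrites a : a \in [:: 0; 2; 6; 8; 18] -> a \notin iwrites (round M).
Proof.
rewrite -[iwrites _]/(iwrites find_candidates ++ iwrites setup_matching ++
  iwrites (cmd_shift 32 M) ++ iwrites init_queue ++ iwrites process_queue ++
  iwrites update_best).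
by rewrite !inE => /or4P[|||/orP[]] /eqP->; rewrite !mem_cat !negb_or iwrites_shift.
Qed.

Lemma round_rwrites a : a < 3 -> a \notin rwrites (round M).
Proof.
move=> a3; rewrite -[rwrites _]/(rwrites (cmd_shift 32 M) ++ [::]) cats0.
by apply: rwrites_shift; lia.
Qed.

(** For [n = 0] the announced bound is a multiple of [f 0] alone, which has to pay for the constant
    overhead. Any run, here on the edgeless graph, takes at least one step. *)
Lemma matching_time_gt0 : 0 < fn.
Proof.
pose st := State (fun a _ => if a == 0 then n else 0) (fun _ _ => 0%R : R).
have [|//|st' [t [ex tf _]]] := matchingM (side := fun _ => false)
  (e := fun _ _ => false) (st := st).
  by split=> // u v; rewrite eqxx.
exact: leq_trans (exec_gt0 ex) tf.
Qed.

Lemma halts_max_clique st : disk_input d st ->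
  let k := num_radii d in
  halts_within (max_clique M) st
    (n * (4 * n + 6) + n * 3 + k * 6 + 13 +
     n ^ (2 * k) * (n * (k * 10 + 12) + n * (n * 14 + 27) + 26 + fn + 12 * k) + 2)
    (fun st' => exists K, is_max_clique (disk_graph d) K /\ subset_output K st').
Proof.
move=> [n0 mE] k.
have kE : size (undup [seq rmem st 2 u | u <- iota 0 n]) = k.
  rewrite -val_enum_ord -map_comp; congr (size (undup _)).
  by apply: eq_map => i /=; have [_ _ ->] := mE i.
have kn : k <= n.
  by apply: leq_trans (size_undup _) _; rewrite size_map size_enum_ord.
apply: halts_bound.
  apply: halts_seq (halts_count_radii n0) _ => st1 ag1; rewrite kE => k1.
  have n1 : imem st1 0 0 = n by rewrite (ag1.1 0 isT).
  apply: halts_seq (halts_reset n1 k1) _ => st2 ag2 [b2 o2 kk2 g2 c2].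
  pose K := 2 * k; pose m := rmem st.
  pose good (g : nat -> nat) := forall t, t < K -> g t < n.
  (* After [j] rounds the guesses of value below [j] have been tried, and the best size dominates
     every clique that fits one of them. *)
  pose covered j s := forall g (A : {set 'I_n}), good g -> value n K g < j ->
    is_clique (disk_graph d) A -> (forall u : 'I_n, u \in A -> candidate m k g u) ->
    #|A| <= best s.
  apply: (@halts_while _ _ _ _ (n ^ K)
      (n * (k * 10 + 12) + n * (n * 14 + 27) + 22 + fn + (K * 6 + 3))
      (fun j s => [/\ [/\ imem s 0 0 = n, imem s 2 0 = k, imem s 18 0 = K &
           forall a x, a < 3 -> rmem s a x = m a x],
         imem s 8 0 <= 1 /\ good (imem s 6),
         value n K (imem s 6) + imem s 8 0 * n ^ K = j,
         best_valid s & covered j s])).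
  - have v0 : value n K (imem st2 6) = 0.
      by rewrite /value big1 // => t _; rewrite g2.
    split.
    + split=> //; first by rewrite (ag2.1 0 isT).
        by rewrite (ag2.1 2 isT).
      by move=> a x _; rewrite (agree_rmem ag2) (agree_rmem ag1).
    (* The digit 0 must be below [n]: if the tuple has an entry at all, then [k > 0], and [k <= n]
       gives [n > 0]. *)
    + rewrite c2; split=> // t tK; rewrite g2 //.
      by move: kn tK; rewrite /K; case: (n) => //; lia.
    + by rewrite v0 c2.
    + exists set0; split; [by move=> u v; rewrite inE|by rewrite cards0|].
      by move=> i; rewrite o2 // inE.
    + by move=> g A _.
  - move=> j s jT [[n' k' K' m'] [c' G'] V' B' C'].
    have c0 : imem s 8 0 = 0.
      by case: (imem s 8 0) V' jT => // x <-; rewrite mulSn; lia.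
    split; first by rewrite /= c0.
    have mEs (i : 'I_n) : [/\ rmem s 0 i = (center (d i)).1,
        rmem s 1 i = (center (d i)).2 & rmem s 2 i = radius (d i)].
      by rewrite !m'.
    apply: halts_seq (halts_round n' k' mEs B') _ => s1 ag3 [B1 le1 cov1].
    have i3 a : a \in [:: 0; 2; 6; 8; 18] -> imem s1 a =1 imem s a.
      by move=> aI; apply: ag3.1; apply: round_iwrites.
    have n3 : imem s1 0 0 = n by rewrite i3.
    have K3 : imem s1 18 0 = K by rewrite i3.
    have G3 : good (imem s1 6) by move=> t tK; rewrite i3 ?G'.
    apply: halts_le (halts_increment n3 K3 G3) (leqnn _) _ => s2 ag4 [c4 G4 V4].
    have b4 : best s2 = best s1 by rewrite /best (ag4.1 17 isT).
    split.
    + split; rewrite ?(ag4.1 0 isT) ?(ag4.1 2 isT) ?(ag4.1 18 isT) ?i3 //.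
      by move=> a x a3; rewrite (agree_rmem ag4) ag3.2 ?m' //; apply: round_rwrites.
    + by [].
    + rewrite V4 -V' c0 addn0; congr _.+1; apply: eq_value => t _; exact: i3.
    + have [A [Acl Asz Aout]] := B1; exists A; split=> //; first by rewrite b4.
      by move=> i; rewrite (ag4.1 1 isT).
    (* Either the guess belongs to an earlier round, or its value is that of the current tuple and,
       base [n] digits being unique, it agrees with that tuple. *)
    + move=> g A gg; rewrite ltnS leq_eqVlt b4 => /predU1P[vE|lt] Acl Ac; last first.
        by apply: leq_trans le1; apply: C' lt Acl Ac.
      apply: cov1 => // u uA; rewrite (candidate_ext (m' := m) (g' := g)) ?Ac //.
      by move=> t tK; apply: (value_inj G' gg _ tK); rewrite vE -V' c0 addn0.
  - move=> s [[n' k' K' m'] [c' G'] V' [A [Acl Asz Aout]] C']; split.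
      (* With [K] digits the value stays below [n ^ K], so after [n ^ K] rounds the carry cannot be
         0. *)
      rewrite /= leqn0; apply/eqP => c0; have := value_lt G'.
      by rewrite -V' c0 addn0 ltnn.
    exists A; split=> //; split=> // A' A'cl; rewrite -Asz.
    have [n_0|n_gt0] := posnP n.
      by rewrite (leq_trans (max_card _)) // card_ord n_0.
    have mEm (i : 'I_n) : [/\ m 0 i = (center (d i)).1,
        m 1 i = (center (d i)).2 & m 2 i = radius (d i)] by apply: mE.
    have [g gn gc] := clique_candidates radius_gt0 mEm n_gt0 A'cl.
    by apply: (C' g) => //; apply: value_lt.
by rewrite -/k; lia.
Qed.
End MaxClique.

Local Open Scope ring_scope.

Theorem theorem3p2 (R : realType) (f : nat -> nat)
    (hf : bipartite_matching_time R f) :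
  exists (P : cmd) (C : nat),
    forall (n k : nat) (d : 'I_n -> disk R) (st : state R),
      (forall i, 0 < radius (d i)) ->
      num_radii d = k ->
      disk_input d st ->
      halts_within P st (C * (n ^ (2 * k) * (f n + n ^ 2)))%N (fun st' =>
        exists K, is_max_clique (disk_graph d) K /\ subset_output K st').
Proof.
(* The constant is 40 for counting, initialization and the last test ([h1]) plus 160 for each round
   ([h2]). *)
have [M hM] := hf; exists (max_clique M), 200%N => n k d st d_gt0 kE input.
apply: halts_bound (halts_max_clique d_gt0 (hM n) input) _; rewrite kE.
have f_gt0 : (0 < f n)%N by apply: (matching_time_gt0 (hM n)).
have kn : (k <= n)%N.
  by rewrite -kE; apply: leq_trans (size_undup _) _; rewrite size_map size_enum_ord.
(* For [n = 0] also [k = 0], and the power is 1: the empty guess is still tried once. *)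
have T_gt0 : (0 < n ^ (2 * k))%N.
  rewrite expn_gt0; have [n0|//] := posnP n.
  by move: kn; rewrite n0 leqn0 => /eqP->.
move: (n ^ (2 * k))%N T_gt0 => T T_gt0.
have n2 : (n <= n ^ 2)%N by rewrite expnS expn1; nia.
have kn2 : (n * k <= n ^ 2)%N by rewrite expnS expn1 leq_mul2l kn orbT.
set X := (f n + n ^ 2)%N.
have h1 : (n * (4 * n + 6) + n * 3 + k * 6 + 15 <= 40 * X)%N by rewrite /X; nia.
have h2 : (n * (k * 10 + 12) + n * (n * 14 + 27) + 26 + f n + 12 * k <= 160 * X)%N.
  by rewrite /X; nia.
have h3 : (40 * X <= T * (40 * X))%N by rewrite leq_pmull.
have := leq_mul (leqnn T) h2; lia.
Qed.
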